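(* Let $m\ge2$ and $S\subseteq\mathfrak{S}_{m+1}$. Then the limit $\lim_{n\to\infty}(\alpha_n(S)/n!)^{1/n}$ exists and equals the spectral radius of the associated operator $T$: $$r(T)=\lim_{n\to\infty}\left(\frac{\alpha_n(S)}{n!}\right)^{1/n}.$$
   Context: For $x$ with distinct coordinates, $\Pi(x)$ is the permutation with $\pi_i<\pi_j$ if and only if $x_i<x_j$. $\alpha_n(S)$ is the number of $\pi\in\mathfrak{S}_n$ with $\Pi(\pi_j,\dots,\pi_{j+m})\notin S$ for all $1\le j\le n-m$. Define $\chi$ on $[0,1]^{m+1}$ by $\chi(x)=0$ if two coordinates coincide or $\Pi(x)\in S$, and $\chi(x)=1$ otherwise. $T$ on $L^2([0,1]^m)$ is $(Tf)(x_1,\dots,x_m)=\int_0^1\chi(t,x_1,\dots,x_m)f(t,x_1,\dots,x_{m-1})\,dt$. *)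

(* Defs.v *)
From HB Require Import structures.
From mathcomp Require Import all_boot all_order all_algebra all_fingroup.
From mathcomp Require Import all_classical all_reals all_analysis.
From mathcomp Require Import complex.

Set Implicit Arguments.
Unset Strict Implicit.
Unset Printing Implicit Defensive.

Import Order.TTheory GRing.Theory Num.Theory.
Import numFieldNormedType.Exports.
Import ComplexField.Normc.

Local Open Scope classical_set_scope.
Local Open Scope ring_scope.
Local Open Scope complex_scope.

Section consecutive_patterns.

(* Pi x is only meaningful for x with distinct coordinates: see PiP for the
   existence and Pi_unique for the uniqueness of such a permutation. *)
Definition Pi {d} {X : orderType d} {n} (x : 'I_n -> X) : 'S_n :=
  odflt 1%g [pick p : 'S_n |
    [forall i, forall j, (p i < p j)%N == (x i < x j)%O]].

Lemma Pi_exists {d} {X : orderType d} {n} (x : 'I_n -> X) : injective x ->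
  exists p : 'S_n, forall i j, (p i < p j)%N = (x i < x j)%O.
Proof.
move=> xI; pose r (i : 'I_n) := #|[pred j | (x j < x i)%O]|.
have rlt i : (r i < n)%N.
  rewrite -[ltnRHS]card_ord -cardsT -cardsE; apply: proper_card.
  apply/properP; split; first by apply/fintype.subsetP => k; rewrite inE.
  by exists i; rewrite ?inE ?ltxx.
have rmono i j : (x i < x j)%O -> (r i < r j)%N.
  move=> xij; apply: proper_card; apply/properP; split.
    by apply/fintype.subsetP => k; rewrite !inE => /lt_trans; apply.
  by exists i; rewrite !inE ?ltxx.
have rE i j : (r i < r j)%N = (x i < x j)%O.
  have [/rmono//|/rmono|/xI ->] := ltgtP (x i) (x j); last by rewrite ltnn.
  by move=> /ltnW; rewrite leqNgt => /negbTE.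
have rI : injective (fun i => Ordinal (rlt i)).
  move=> i j /(congr1 val) /= rij; apply: xI.
  by case: (ltgtP (x i) (x j)) => // /rmono; rewrite rij ltnn.
by exists (perm rI) => i j; rewrite !permE /= rE.
Qed.

Lemma PiP {d} {X : orderType d} {n} (x : 'I_n -> X) : injective x ->
  forall i j, (Pi x i < Pi x j)%N = (x i < x j)%O.
Proof.
move=> xI i j; rewrite /Pi; case: pickP => [p /forallP/(_ i)/forallP/(_ j)/eqP//|].
have [p pE] := Pi_exists xI => /(_ p)/negP[].
by apply/forallP => k; apply/forallP => l; rewrite pE.
Qed.

Lemma Pi_unique {d} {X : orderType d} {n} (x : 'I_n -> X) (p : 'S_n) :
  injective x -> (forall i j, (p i < p j)%N = (x i < x j)%O) -> p = Pi x.
Proof.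
move=> xI pE.
have rank (q : 'S_n) i : #|[pred j | (q j < q i)%N]| = q i.
  rewrite -(card_imset _ (@perm_inj _ q)).
  rewrite -[RHS](card_ord (q i)).
  have lei : (q i <= n)%N by exact: ltnW.
  have wI : injective (widen_ord lei) by move=> a b /(congr1 val)/= /val_inj.
  rewrite -(card_imset _ wI).
  apply: eq_card => k; apply/imsetP/imsetP => [[j] /[!inE] ji ->|[j _ ->]].
    by exists (Ordinal ji) => //; exact/val_inj.
  exists ((q^-1)%g (widen_ord lei j)); last by rewrite permKV.
  by rewrite !inE permKV /=.
apply/permP => i; apply/val_inj; rewrite /= -rank -[RHS]rank.
by apply: eq_card => j; rewrite !inE PiP.
Qed.

Lemma window_subproof {m n} (j : 'I_(n - m)) (k : 'I_m.+1) : (j + k < n)%N.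
Proof.
have jm : (j + m < n)%N by rewrite addnC -ltn_subRL.
by apply: leq_ltn_trans jm; rewrite leq_add2l -ltnS.
Qed.

(* Positions are numbered from 0: j : 'I_(n - m) is the start of the window
   occupying the m + 1 positions j, ..., j + m. *)
Definition window {m n} (p : 'S_n) (j : 'I_(n - m)) (k : 'I_m.+1) : nat :=
  p (Ordinal (window_subproof j k)).

Definition alpha {m} (S : {set 'S_m.+1}) (n : nat) : nat :=
  #|[pred p : 'S_n | [forall j : 'I_(n - m), Pi (window p j) \notin S]]|.

End consecutive_patterns.

Section cube.
Context (R : realType).

Definition cons_tuple {n} (z : measurableTypeR R * n.-tuple (measurableTypeR R)) :
  n.+1.-tuple (measurableTypeR R) := [tuple of z.1 :: z.2].

Lemma measurable_cons_tuple n : measurable_fun setT (@cons_tuple n).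
Proof. exact: measurable_cons. Qed.

HB.instance Definition _ n :=
  isMeasurableFun.Build _ _ _ _ (@cons_tuple n) (@measurable_cons_tuple n).

(* Lebesgue measure on [0, 1]^n, as the n-fold product of the uniform measure
   of [0, 1]. It lives on R^n but gives no mass to the complement of the cube,
   so functions on the cube are functions on R^n modulo null sets. *)
Fixpoint cube (n : nat) : probability (n.-tuple (measurableTypeR R)) R :=
  if n is n'.+1 then
    distribution (uniform_prob (@ltr01 R) \x cube n')%E (@cons_tuple n')
  else \d_([tuple] : 0.-tuple (measurableTypeR R)).

End cube.

(* Complex L^2 spaces are handled through representatives: elements are
   square-integrable functions, and equality is almost-everywhere equality. *)
Section L2_operators.
Context d (X : measurableType d) (R : realType).
Variable mu : {measure set X -> \bar R}.
Implicit Types (f g : X -> R[i]) (A T : (X -> R[i]) -> (X -> R[i])).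

Definition L2 : set (X -> R[i]) :=
  [set f | ((fun x => complex.Re (f x)) \in Lfun mu 2%:E) /\
           ((fun x => complex.Im (f x)) \in Lfun mu 2%:E)].

Definition L2norm f : \bar R := Lnorm mu 2%:E (fun x => (normc (f x))%:E).

Definition bounded_operator A : Prop :=
  [/\ (forall f, L2 f -> L2 (A f)),
      (forall f g, L2 f -> L2 g -> f = g %[ae mu] -> A f = A g %[ae mu]),
      (forall (c : R[i]) f g, L2 f -> L2 g ->
        A (fun x => c * f x + g x) = (fun x => c * A f x + A g x) %[ae mu]) &
      exists M : R, forall f, L2 f -> (L2norm (A f) <= M%:E * L2norm f)%E].

Definition resolvent_set T : set R[i] :=
  [set l | exists A, bounded_operator A /\
    forall f, L2 f ->
      A (fun x => l * f x - T f x) = f %[ae mu] /\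
      (fun x => l * A f x - T (A f) x) = f %[ae mu]].

Definition spectrum T : set R[i] := ~` resolvent_set T.

(* Taken in the extended reals, so that no junk value is used should the
   spectrum be empty or unbounded. *)
Definition spectral_radius T : \bar R :=
  ereal_sup [set (normc l)%:E | l in spectrum T].

End L2_operators.

Section pattern_operator.
Context (R : realType) (m : nat) (S : {set 'S_m.+1}).

Definition chi (x : m.+1.-tuple R) : R :=
  if uniq x && (Pi (tnth x) \notin S) then 1 else 0.

Definition Cintegral (D : set R) (g : R -> R[i]) : R[i] :=
  (\int[lebesgue_measure]_(t in D) complex.Re (g t)) +i*
  (\int[lebesgue_measure]_(t in D) complex.Im (g t)).

(* [tuple (t :: x)`_i | i < m] is (t, x_1, ..., x_(m-1)) *)
Definition Top (f : m.-tuple R -> R[i]) (x : m.-tuple R) : R[i] :=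
  Cintegral `[0, 1]
    (fun t => (chi [tuple of t :: x])%:C * f [tuple (t :: x)`_i | i < m]).

End pattern_operator.

(* Main.v *)
(** The associated operator [T] is a composition of an integration in the first
    variable with a 0/1 weight, so for [a n = alpha n / n!], the probability
    that [n] independent uniform points avoid [S], one has
    [a (n + m) = <T^n 1, 1>], while [T^m] maps [L^1] to bounded functions:
    [|T^(j + m) f| <= a j * ||f||_1] everywhere.  Disjoint windows being
    independent, [a] is submultiplicative, so by Fekete's lemma [(a n)^(1/n)]
    converges to [L] with [L^n <= a n] and [a n = O(r^n)] for all [r > L].
    If [|l| > L], the Neumann series of [T] at [l] therefore converges uniformly
    up to finitely many terms and defines a resolvent.  Conversely positivity
    makes [L] itself a spectral value: a bounded inverse of [L - T] would keep
    the partial Neumann sums of the constant 1 at [L + e] bounded in [L^2] as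
    [e] tends to 0, whereas their means are bounded below by a multiple of
    [1 / e]. *)
Require Import Defs.
From HB Require Import structures.
From mathcomp Require Import all_boot all_order all_algebra all_fingroup.
From mathcomp Require Import all_classical all_reals all_analysis.
From mathcomp Require Import measurable_realfun complex ring lra.

Import Order.TTheory GRing.Theory Num.Theory.
Import numFieldNormedType.Exports.
Local Open Scope classical_set_scope.
Local Open Scope ring_scope.

Set Implicit Arguments.
Unset Strict Implicit.
Unset Printing Implicit Defensive.

(** * Iterated integrals over the unit cube *)

(** The upper bound asks for one explicit resolvent at each [l] with modulus above [L], the lower
    bound for a single spectral value, and both can be checked on functions. The obstacle is the
    interplay of pointwise and almost-everywhere statements. Comparison estimates for [T] hold at
    every point, because a non-integrable section has real integral 0; linearity of [T] holds only
    almost everywhere. Inequalities are therefore proved everywhere, while identities between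
    Neumann sums are proved for each [n] off a null set and joined by a countable intersection. A
    second obstacle is that a bounded [f] is only available after [m] applications of [T]: the first
    [m] Neumann terms are controlled in [L^2], and uniform bounds start at index [m]. In the
    converse no limit in [e] is taken: the bound [M] of the supposed inverse dictates one [e] and
    one [n] for which the [L^2] bound and the mean are incompatible. *)

Section iterated_integral.
Context (R : realType).
Local Notation mR := (measurableTypeR R).
Local Notation U := (uniform_prob (@ltr01 R)).
Local Open Scope ereal_scope.
Implicit Types (h k : seq R -> \bar R) (s u : seq R).

(* A function on lists stands for one function on each [R^n]: [iter n iint h [::]]
   is the integral of [h] over the [n]-cube (lemma [integral_cube]), and prefixing
   integration variables to a list avoids all tuple-size bookkeeping. *)
Definition smf d (Y : measurableType d) (h : seq R -> Y) :=
  forall n, measurable_fun setT (fun s : n.-tuple mR => h s).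

Definition snn h := smf h /\ forall s, 0 <= h s.

Definition iint h s := \int[U]_t h (t :: s).

Lemma smf_pair d (Y : measurableType d) (h : seq R -> Y) n : smf h ->
  measurable_fun setT (fun z : mR * n.-tuple mR => h (z.1 :: z.2)).
Proof.
move=> mh; exact: (measurableT_comp (mh n.+1) (@measurable_cons_tuple R n)).
Qed.

Lemma smf_section d (Y : measurableType d) (h : seq R -> Y) s : smf h ->
  measurable_fun setT (fun t : mR => h (t :: s)).
Proof.
move=> mh; apply: (measurableT_comp (smf_pair (n := size s) mh)
  (g := fun t : mR => (t, in_tuple s : (size s).-tuple mR))).
exact: measurable_fun_pair.
Qed.

Lemma snn_cst (c : \bar R) : 0 <= c -> snn (cst c).
Proof. by move=> c0; split=> // n; exact: measurable_cst. Qed.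

Lemma snnD h k : snn h -> snn k -> snn (fun s => h s + k s).
Proof.
move=> [mh h0] [mk k0]; split=> [n|s]; last by rewrite adde_ge0.
exact: (emeasurable_funD (mh n) (mk n)).
Qed.

Lemma snnM h k : snn h -> snn k -> snn (fun s => h s * k s).
Proof.
move=> [mh h0] [mk k0]; split=> [n|s]; last by rewrite mule_ge0.
exact: (emeasurable_funM (mh n) (mk n)).
Qed.

Lemma iint_ge0 h s : (forall s, 0 <= h s) -> 0 <= iint h s.
Proof. by move=> h0; apply: integral_ge0 => t _. Qed.

Lemma snn_iint h : snn h -> snn (iint h).
Proof.
move=> [mh h0]; split=> [n|s]; last exact: iint_ge0.
have := @measurable_fun_fubini_tonelli_G _ _ _ _ _ U _ (smf_pair (n := n) mh).
by apply=> z; exact: h0.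
Qed.

Lemma snn_iter h n : snn h -> snn (iter n iint h).
Proof. by move=> hh; elim: n => //= n; exact: snn_iint. Qed.

Lemma le_iint h k s : snn h -> snn k -> (forall t, h (t :: s) <= k (t :: s)) ->
  iint h s <= iint k s.
Proof.
move=> [mh h0] [mk k0] hk; apply: ge0_le_integral => //.
- exact: smf_section.
- exact: smf_section.
Qed.

Lemma le_iter_iint h k n s : snn h -> snn k ->
  (forall u, (size u = n + size s)%N -> h u <= k u) -> iter n iint h s <= iter n iint k s.
Proof.
move=> hh kk; elim: n s => [|n IH] s hk; first exact: hk.
rewrite !iterS; apply: le_iint => [||t]; try exact: snn_iter.
by apply: IH => u /= su; apply: hk; rewrite su addnS.
Qed.

Lemma eq_iter_iint h k n s : 
  (forall u, (size u = n + size s)%N -> h u = k u) -> iter n iint h s = iter n iint k s.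
Proof.
elim: n s => [|n IH] s hk; first exact: hk.
rewrite !iterS; apply: eq_integral => t _.
by apply: IH => u /= su; apply: hk; rewrite su addnS.
Qed.

Lemma iter_iintD h k n s : snn h -> snn k ->
  iter n iint (fun s => h s + k s) s = iter n iint h s + iter n iint k s.
Proof.
move=> hh kk; elim: n s => // n IH s; rewrite !iterS /iint.
under eq_integral do rewrite IH.
have [mh h0] := snn_iter n hh; have [mk k0] := snn_iter n kk.
by rewrite ge0_integralD//; exact: smf_section.
Qed.

Lemma iter_iintZ h (c : \bar R) n s : snn h -> 0 <= c ->
  iter n iint (fun s => c * h s) s = c * iter n iint h s.
Proof.
move=> hh c0; elim: n s => // n IH s; rewrite !iterS /iint.
under eq_integral do rewrite IH.
have [mh h0] := snn_iter n hh.
by rewrite ge0_integralZl//; exact: smf_section.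
Qed.

Lemma iter_iint_cst (c : \bar R) n s : 0 <= c -> iter n iint (cst c) s = c.
Proof.
move=> c0; elim: n s => // n IH s; rewrite iterS /iint.
under eq_integral do rewrite IH.
by rewrite integral_cst// [X in _ * X](@probability_setT _ _ _ U) mule1.
Qed.

Lemma integral_cube h n : snn h ->
  \int[cube R n]_x h (x : n.-tuple mR) = iter n iint h [::].
Proof.
elim: n h => [|n IH] h [mh h0].
  by rewrite integral_dirac//= ?diracT ?mul1e//; exact: (mh 0%N).
(* The head of the list is integrated innermost, matching [cube n.+1] as the image of a product
   under cons. *)
rewrite iterSr -IH; last exact: snn_iint.
rewrite [LHS](ge0_integral_distribution _ (mh n.+1))//.
rewrite (fubini_tonelli2 (fun z : mR * n.-tuple mR => h (z.1 :: z.2)))//.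
exact: smf_pair.
Qed.

(** Adjacent transpositions are taken as generators because Tonelli's theorem exchanges two
    consecutive integrations. *)
Fixpoint swap_at j s := match j, s with
  | 0%N, a :: b :: s' => b :: a :: s'
  | j'.+1, a :: s' => a :: swap_at j' s'
  | _, _ => s end.

Lemma smf_swap2 d (Y : measurableType d) n (h : n.+2.-tuple mR -> Y) :
  measurable_fun setT h ->
  measurable_fun setT (fun z : (mR * mR) * n.-tuple mR => h [tuple of z.1.1 :: z.1.2 :: z.2]).
Proof.
move=> mh; apply: (measurableT_comp mh).
apply: (measurable_cons (f := fun z : (mR * mR) * n.-tuple mR => z.1.1)
   (g := fun z => [tuple of z.1.2 :: z.2])).
  exact: measurableT_comp.
apply: measurable_cons => //.
exact: measurableT_comp.
Qed.

Lemma iint_swap h s : snn h ->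
  iint (iint (fun s => h (swap_at 0 s))) s = iint (iint h) s.
Proof.
move=> [mh h0]; rewrite /iint /=.
have := @fubini_tonelli _ _ _ _ _ U U (fun z : mR * mR => h (z.1 :: z.2 :: s)).
apply=> //=.
apply: (measurableT_comp (smf_swap2 (mh (size s).+2))
  (g := fun z : mR * mR => (z, in_tuple s : (size s).-tuple mR))).
exact: measurable_fun_pair.
Qed.

Lemma iter_iint_swap h n j s : snn h -> (j.+1 < n)%N ->
  iter n iint (fun s => h (swap_at j s)) s = iter n iint h s.
Proof.
elim: j n h => [|j IH] [//|n] h hh jn.
  by case: n jn => // n _; rewrite !iterSr; apply: eq_iter_iint => u _; exact: iint_swap.
(* [swap_at j.+1] does not touch the head, which is integrated innermost; so the claim for [h] at
   [j.+1] is the claim for [iint h] at [j]. *)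
by rewrite !iterSr; apply: (IH n (iint h)) => //; exact: snn_iint.
Qed.

End iterated_integral.

Arguments iint {R} h s.

(** * Measurability through finitely many tests *)

Section finite_tests.
Context d (T : measurableType d) (I : finType).

(** Distinctness and the relative order of coordinates depend only on a finite table of comparisons,
    so their measurability reduces to that of the sets where one coordinate is below another. *)
Lemma measurable_fun_finite_tests d' (Y : measurableType d') (c : I -> T -> bool)
    (F : {ffun I -> bool} -> Y) :
  (forall i, measurable [set x | c i x]) ->
  measurable_fun setT (fun x => F [ffun i => c i x]).
Proof.
move=> mc _ B mB; rewrite setTI.
rewrite (_ : _ @^-1` B = \bigcup_(y in [set y | B (F y)])
  \bigcap_(i in [set: I]) (if y i then [set x | c i x] else ~` [set x | c i x])).
  apply: fin_bigcup_measurable => // y _.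
  apply: fin_bigcap_measurable => // i _.
  by case: ifP => _; [exact: mc|apply: measurableC; exact: mc].
apply/seteqP; split=> x /=.
  move=> Bx; exists [ffun i => c i x] => // i _ /=.
  by rewrite ffunE; case: ifPn => //= /negP.
move=> [y By yx]; rewrite (_ : [ffun i => c i x] = y)//.
apply/ffunP => i; rewrite ffunE; have := yx i Logic.I.
by case: ifP => _ /=; [move=> ->|move=> /negP/negbTE ->].
Qed.

End finite_tests.

(** * Invariance under permutation of the variables *)

Section permutation_invariance.
Context (R : realType).
Local Notation mR := (measurableTypeR R).
Local Open Scope ereal_scope.
Implicit Types (h k : seq R -> \bar R) (s u : seq R).

Lemma measurable_nth n i : measurable_fun setT (fun s : n.-tuple mR => (s : seq R)`_i : mR).
Proof.
have [lein|ltin] := ltnP i n.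
  rewrite (_ : (fun _ => _) = fun s : n.-tuple mR => tnth s (Ordinal lein)).
    exact: measurable_tnth.
  by apply/funext => s; rewrite (tnth_nth 0%R).
rewrite (_ : (fun _ => _) = cst 0%R); first exact: measurable_cst.
by apply/funext => s; rewrite nth_default// size_tuple.
Qed.

Lemma smf_tuple d (Y : measurableType d) n (f : 'I_n -> nat) (h : n.-tuple R -> Y) :
  measurable_fun setT (h : n.-tuple mR -> Y) ->
  smf (fun s : seq R => h [tuple s`_(f i) | i < n]).
Proof.
move=> mh k.
apply: (measurableT_comp mh (g := fun s : k.-tuple mR => [tuple (s : seq R)`_(f i) | i < n])).
apply/measurable_fun_tnthP => i.
rewrite (_ : _ \o _ = fun s : k.-tuple mR => (s : seq R)`_(f i)); first exact: measurable_nth.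
by apply/funext => s /=; rewrite tnth_mktuple.
Qed.

Definition pact n (p : 'S_n) s : n.-tuple R := [tuple s`_(p i) | i < n].

Lemma snn_pact n (p : 'S_n) h : snn h -> snn (fun s => h (pact p s)).
Proof.
move=> [mh h0]; split => //.
exact: (smf_tuple (fun i => p i) (h := fun s : n.-tuple R => h s) (mh n)).
Qed.

Lemma pactM n (p q : 'S_n) s : pact (p * q) s = pact p (pact q s).
Proof.
apply: eq_from_tnth => i; rewrite !tnth_mktuple permM -tnth_nth ?tnth_mktuple//.
Qed.

Lemma nth_pact n (p : 'S_n) s (i : 'I_n) : (pact p s : seq R)`_i = s`_(p i).
Proof. by rewrite -tnth_nth tnth_mktuple. Qed.

Lemma nth_swap_at j s i : (j.+1 < size s)%N ->
  (swap_at j s)`_i = s`_(if i == j then j.+1 else if i == j.+1 then j else i).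
Proof.
elim: j s i => [|j IH] [|a s] i //=.
  by case: s => // b s _; case: i => [|[|i]].
rewrite ltnS; case: i => [|i] js //=.
by rewrite IH// !eqSS; case: ifP => // _; case: ifP.
Qed.

Lemma size_swap_at j s : size (swap_at j s) = size s.
Proof.
elim: j s => [|j IH] [|a s] //=; first by case: s.
by rewrite IH.
Qed.

Definition invariant_perm n (p : 'S_n) := forall h, snn h ->
  iter n (@iint R) (fun s => h (pact p s)) [::] = iter n (@iint R) h [::].

Lemma invariant_permM n (p q : 'S_n) :
  invariant_perm p -> invariant_perm q -> invariant_perm (p * q).
Proof.
move=> ip iq h hh; rewrite -(ip h hh) -(iq (fun s => h (pact p s))); last exact: snn_pact.
by apply: eq_iter_iint => u _; rewrite pactM.
Qed.

Lemma invariant_perm1 n : invariant_perm (1 : 'S_n)%g.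
Proof.
move=> h hh; apply: eq_iter_iint => u /=; rewrite addn0 => su; congr h.
apply: (@eq_from_nth _ 0%R); first by rewrite size_map size_enum_ord.
move=> i; rewrite size_map size_enum_ord => ilt.
by have := nth_pact 1%g u (Ordinal ilt); rewrite perm1.
Qed.

Lemma invariant_perm_adjacent n (x y : 'I_n) : y = x.+1 :> nat ->
  invariant_perm (tperm x y).
Proof.
move=> yx h hh; rewrite -[RHS](iter_iint_swap (j := x)) //; last by rewrite -yx.
apply: eq_iter_iint => u /=; rewrite addn0 => su; congr h.
apply: (@eq_from_nth _ 0%R); first by rewrite size_map size_enum_ord size_swap_at.
move=> i; rewrite size_map size_enum_ord => ilt.
rewrite nth_swap_at ?su -?yx//.
have /= -> := nth_pact (tperm x y) u (Ordinal ilt).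
congr nth; case: tpermP => [/(congr1 val)/= ->|/(congr1 val)/= ->|].
- by rewrite eqxx.
- by rewrite eqxx gtn_eqF// yx.
move=> /eqP xi /eqP yi.
by move: xi yi; rewrite -!val_eqE/= => /negbTE -> /negbTE ->.
Qed.

(** Induction on the distance: with [y'] the predecessor of [y], the transposition of [x] and [y] is
    that of [x] and [y'] conjugated by the adjacent one of [y'] and [y]. *)
Lemma invariant_tperm n (x y : 'I_n) : (x < y)%N -> invariant_perm (tperm x y).
Proof.
move=> xy; have [k kE] : exists k : nat, (y = x + k.+1 :> nat)%N.
  by exists (y - x.+1)%N; rewrite addnS -addSn subnKC.
elim: k y xy kE => [|k IH] y xy kE.
  by apply: invariant_perm_adjacent; rewrite kE addn1.
have y'lt : (x + k.+1 < n)%N by apply: leq_trans (ltn_ord y); rewrite kE ltnS leq_add2l.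
pose y' := Ordinal y'lt.
have ay : invariant_perm (tperm y' y).
  by apply: invariant_perm_adjacent; rewrite kE/= !addnS.
have -> : tperm x y = (tperm x y' ^ tperm y' y)%g.
  rewrite tpermJ tpermL tpermD// -val_eqE/=.
    by rewrite gtn_eqF// -[ltnLHS]addn0 ltn_add2l.
  by rewrite gtn_eqF.
rewrite /conjg tpermV; apply: invariant_permM => //; apply: invariant_permM => //.
by apply: IH => //=; rewrite -[ltnLHS]addn0 ltn_add2l.
Qed.

Lemma invariant_permT n (p : 'S_n) : invariant_perm p.
Proof.
have [ts -> _] := prod_tpermP p.
elim: ts => [|[x y] ts IH]; first by rewrite big_nil; exact: invariant_perm1.
rewrite big_cons; apply: invariant_permM => //=.
have [xy|xy|/val_inj ->] := ltngtP x y; first exact: invariant_tperm.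
  by rewrite tpermC; exact: invariant_tperm.
by rewrite tperm1; exact: invariant_perm1.
Qed.

Definition iuniq s : \bar R := (uniq s)%:R%:E.

Lemma smf_nth i : smf (fun s : seq R => s`_i : mR).
Proof. by move=> n; exact: measurable_nth. Qed.

Lemma measurable_nth_lt n i j :
  measurable [set s : n.-tuple mR | ((s : seq R)`_i < (s : seq R)`_j)%R].
Proof.
have := measurable_fun_ltr (smf_nth i (n:=n)) (smf_nth j (n:=n)).
move=> /(_ measurableT [set true]); rewrite setTI.
by apply.
Qed.

Lemma uniq_nth_lt n (s : seq R) : size s = n ->
  uniq s = [forall i : 'I_n, forall j : 'I_n, (i != j) ==> (s`_i < s`_j)%R || (s`_j < s`_i)%R].
Proof.
move=> sn; apply/(uniqP 0%R)/forallP => [us i|us i j].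
  apply/forallP => j; apply/implyP => ij; rewrite -neq_lt.
  by apply: contra ij => /eqP /us; rewrite !inE sn !ltn_ord => /(_ isT isT)/val_inj ->.
rewrite !inE sn => il jl sij.
have /forallP/(_ (Ordinal jl)) := us (Ordinal il).
rewrite -val_eqE/= sij ltxx orbb; case: eqP => //.
Qed.

Lemma snn_iuniq : snn iuniq.
Proof.
split=> [n|s]; last by rewrite lee_fin.
pose c (ij : 'I_n * 'I_n) (s : n.-tuple mR) := ((s : seq R)`_ij.1 < (s : seq R)`_ij.2)%R.
pose F (y : {ffun 'I_n * 'I_n -> bool}) : \bar R :=
  [forall i : 'I_n, forall j : 'I_n, (i != j) ==> y (i, j) || y (j, i)]%:R%:E.
rewrite (_ : (fun _ => _) = fun s : n.-tuple mR => F [ffun ij => c ij s]).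
  by apply: measurable_fun_finite_tests => ij; exact: measurable_nth_lt.
apply/funext => s; rewrite /iuniq (@uniq_nth_lt n) ?size_tuple//; congr (_%:R%:E).
congr (nat_of_bool _); apply: eq_forallb => i; apply: eq_forallb => j.
by rewrite !ffunE.
Qed.

Lemma measurable_seq (s : seq mR) : measurable [set` s].
Proof.
apply: countable_measurable; first exact: measurable_set1.
exact/finite_set_countable/finite_seq.
Qed.

Lemma uniform_prob_seq (s : seq mR) : uniform_prob (@ltr01 R) [set` s] = 0.
Proof.
apply: (@dominates_uniform_prob _ _ _ _ [set` s]) => //; last exact: measurable_seq.
move=> A mA As; apply: countable_lebesgue_measure0.
exact/finite_set_countable/(sub_finite_set As)/finite_seq.
Qed.

(** For [s] with distinct entries, the values [t] that create a repetition are the entries of [s], a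
    finite and hence null set. This discards the points where [Pi] has no meaning. *)
Lemma iint_uniq h s : snn h ->
  iint (fun s => h s * iuniq s) s = iint h s * iuniq s.
Proof.
move=> hh; have [mh h0] := snnM hh snn_iuniq; have [mh' h0'] := hh.
rewrite /iint; case us : (uniq s); last first.
  under eq_integral do rewrite /iuniq/= us andbF mule0.
  by rewrite integral0 /iuniq us mule0.
rewrite {2}/iuniq us mule1.
apply: ge0_ae_eq_integral => //.
- exact: (smf_section _ mh).
- exact: smf_section.
exists [set` s]; split; [|exact: uniform_prob_seq|].
  exact: measurable_seq.
move=> t /= nt; apply: contrapT => /negP ts; apply: nt => _.
by rewrite /iuniq /= ts us mule1.
Qed.

Lemma iter_iint_uniq h n s : snn h ->
  iter n (@iint R) (fun s => h s * iuniq s) s = iter n (@iint R) h s * iuniq s.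
Proof.
elim: n h => // n IH h hh.
rewrite !iterSr -IH; last exact: snn_iint.
by apply: eq_iter_iint => u _; exact: iint_uniq.
Qed.

Lemma iter_iint_sum (I : Type) (r : seq I) (F : I -> seq R -> \bar R) n s :
  (forall i, snn (F i)) ->
  iter n (@iint R) (fun s => \sum_(i <- r) F i s) s = \sum_(i <- r) iter n (@iint R) (F i) s.
Proof.
move=> hF; elim: r => [|i r IH].
  under eq_iter_iint do rewrite big_nil.
  by rewrite big_nil iter_iint_cst.
under eq_iter_iint do rewrite big_cons.
rewrite big_cons iter_iintD ?IH//.
split=> [k|u]; last by apply: sume_ge0 => j _; exact: (hF j).2.
by apply: emeasurable_sum => j; exact: (hF j).1.
Qed.

End permutation_invariance.

(** * Avoidance probabilities *)

Section avoidance.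
Context (R : realType) (m : nat) (S : {set 'S_m.+1}).
Local Notation mR := (measurableTypeR R).
Implicit Types (s u : seq R).

Lemma nth_wtuple k s (i : 'I_k) : ([tuple s`_j | j < k] : seq R)`_i = s`_i.
Proof. by rewrite -tnth_nth tnth_mktuple. Qed.

Definition wnd s : R := chi S [tuple s`_i | i < m.+1].

(** A window takes [m + 1] entries, one of them the head, hence the test [m <= size s']. Without it
    [wnd] would read padding zeros past the end of the list. *)
Fixpoint avoid s : R :=
  if s is _ :: s' then (if (m <= size s')%N then wnd s else 1) * avoid s' else 1.

Lemma wnd01 s : wnd s = 0 \/ wnd s = 1.
Proof. by rewrite /wnd /chi; case: ifP; [right|left]. Qed.

Lemma wnd_ge0 s : 0 <= wnd s.
Proof. by case: (wnd01 s) => ->. Qed.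

Lemma wnd_le1 s : wnd s <= 1.
Proof. by case: (wnd01 s) => ->. Qed.

Lemma avoid_ge0 s : 0 <= avoid s.
Proof.
elim: s => //= t s IH; apply: mulr_ge0 => //.
by case: ifP => // _; exact: wnd_ge0.
Qed.

Lemma avoid_le1 s : avoid s <= 1.
Proof.
elim: s => //= t s IH; case: ifP => _; last by rewrite mul1r.
by rewrite mulr_ile1 ?wnd_ge0 ?wnd_le1 ?avoid_ge0.
Qed.

Lemma wnd_cat s u : (m < size s)%N -> wnd (s ++ u) = wnd s.
Proof.
move=> ms; rewrite /wnd; congr chi; apply: eq_from_tnth => i.
by rewrite !tnth_mktuple nth_cat (leq_trans (ltn_ord i) ms).
Qed.

(** The windows that straddle the junction are dropped; each is a factor at most 1. *)
Lemma avoid_cat s u : avoid (s ++ u) <= avoid s * avoid u.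
Proof.
elim: s => [|t s IH] /=; first by rewrite mul1r.
rewrite -mulrA size_cat; case: ifP => [msu|msu].
  case: ifP => [ms|ms]; last first.
    rewrite mul1r; apply: le_trans IH; rewrite ler_piMl ?avoid_ge0 ?wnd_le1//.
  by rewrite -cat_cons wnd_cat//= ler_wpM2l ?wnd_ge0.
rewrite mul1r ifF ?mul1r//; apply: contraFF msu => /leq_trans; apply.
exact: leq_addr.
Qed.

Lemma avoid_short s : (size s <= m)%N -> avoid s = 1.
Proof.
elim: s => //= t s IH sm; rewrite IH ?(ltnW sm)// mulr1.
by rewrite leqNgt sm.
Qed.

Lemma smf_wnd : smf (wnd : _ -> mR).
Proof.
pose I := ('I_m.+1 * 'I_m.+1)%type.
pose c (n : nat) (ij : I) (s : n.-tuple mR) := ((s : seq R)`_ij.1 < (s : seq R)`_ij.2)%R.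
pose F (y : {ffun I -> bool}) : mR :=
  if [forall i : 'I_m.+1, forall j : 'I_m.+1, (i != j) ==> y (i, j) || y (j, i)]
    && (odflt 1%g [pick p : 'S_m.+1 |
    [forall i, forall j, (p i < p j)%N == y (i, j)]] \notin S) then 1 else 0.
move=> n.
rewrite (_ : (fun _ => _) = fun s : n.-tuple mR => F [ffun ij => c n ij s]).
  by apply: measurable_fun_finite_tests => ij; exact: measurable_nth_lt.
apply/funext => s; rewrite /wnd /chi /F; congr (if _ && (_ \notin S) then _ else _).
  rewrite (@uniq_nth_lt R m.+1) ?size_tuple//.
  apply: eq_forallb => i; apply: eq_forallb => j.
  by rewrite !ffunE /c /= !nth_wtuple.
congr odflt; apply: eq_pick => p; apply: eq_forallb => i; apply: eq_forallb => j.
by rewrite !ffunE /c /= !tnth_mktuple.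
Qed.

Lemma measurable_behead_avoid n : measurable_fun setT
  (fun s : n.+1.-tuple mR => avoid (behead s) : mR) ->
  measurable_fun setT (fun s : n.+1.-tuple mR => avoid s : mR).
Proof.
move=> mb; rewrite (_ : (fun _ => _) = fun s : n.+1.-tuple mR =>
  (if (m <= n)%N then wnd s else 1) * avoid (behead s)).
  apply: measurable_funM => //.
  by case: (m <= n)%N; [exact: smf_wnd|exact: measurable_cst].
by apply/funext => s; case: s => [[|t s]]//= /eqP[ss]; rewrite ss.
Qed.

Lemma smf_avoid : smf (avoid : _ -> mR).
Proof.
elim=> [|n IH].
  rewrite (_ : (fun _ => _) = cst 1); first exact: measurable_cst.
  by apply/funext => s; rewrite tuple0.
apply: measurable_behead_avoid.
exact: (measurableT_comp IH (g := fun s : n.+1.-tuple mR => [tuple of behead s])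
  (@measurable_behead _ mR n)).
Qed.

Lemma snn_avoid : snn (fun s => (avoid s)%:E).
Proof.
split=> [n|s]; last by rewrite lee_fin avoid_ge0.
by apply/measurable_EFinP; exact: smf_avoid.
Qed.

Lemma snn_wnd : snn (fun s => (wnd s)%:E).
Proof.
split=> [n|s]; last by rewrite lee_fin wnd_ge0.
by apply/measurable_EFinP; exact: smf_wnd.
Qed.

Definition avoidP (n : nat) : R := fine (iter n (@iint R) (fun s => (avoid s)%:E) [::]).

Lemma iter_avoid_le1 n s : (iter n (@iint R) (fun s => (avoid s)%:E) s <= 1)%E.
Proof.
rewrite -(iter_iint_cst n s (@lee01 R)).
apply: le_iter_iint; [exact: snn_avoid|exact: snn_cst|].
by move=> u _; rewrite lee_fin avoid_le1.
Qed.

Lemma avoidPE n : (avoidP n)%:E = iter n (@iint R) (fun s => (avoid s)%:E) [::].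
Proof.
rewrite /avoidP fineK// ge0_fin_numE; last exact: (snn_iter n snn_avoid).2.
exact: le_lt_trans (iter_avoid_le1 n [::]) (ltry _).
Qed.

Lemma avoidP_ge0 n : 0 <= avoidP n.
Proof. by rewrite -lee_fin avoidPE; exact: (snn_iter n snn_avoid).2. Qed.

Lemma avoidP_le1 n : avoidP n <= 1.
Proof. by rewrite -lee_fin avoidPE; exact: iter_avoid_le1. Qed.

Lemma iint_cat (h : seq R -> \bar R) n s :
  iter n (@iint R) h s = iter n (@iint R) (fun u => h (u ++ s)) [::].
Proof.
have catE k u v : iter k (@iint R) h (u ++ v) = iter k (@iint R) (fun u => h (u ++ v)) u.
  elim: k u => // k IH u; rewrite !iterS /iint.
  by apply: eq_integral => t _; rewrite -IH.
by rewrite -catE.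
Qed.

Lemma snn_cat (h : seq R -> \bar R) s : snn h -> snn (fun u => h (u ++ s)).
Proof.
move=> [mh h0]; split=> // n.
apply: (@measurableT_comp _ _ _ _ _ _ (fun v : (n + size s).-tuple mR => h v) _
  (fun u : n.-tuple mR => cat_tuple u (in_tuple s : (size s).-tuple mR))).
  exact: (mh (n + size s)%N).
apply/measurable_fun_tnthP => i.
have [j|j] := split_ordP i => ->.
  rewrite (_ : _ \o _ = fun u : n.-tuple mR => tnth u j); first exact: measurable_tnth.
  by apply/funext => u /=; rewrite tnth_lshift.
rewrite (_ : _ \o _ = cst (tnth (in_tuple s) j)); first exact: measurable_cst.
by apply/funext => u /=; rewrite tnth_rshift.
Qed.

Lemma iter_avoid_le n s :
  (iter n (@iint R) (fun s => (avoid s)%:E) s <= (avoid s)%:E * (avoidP n)%:E)%E.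
Proof.
rewrite iint_cat avoidPE -iter_iintZ ?lee_fin ?avoid_ge0//; last exact: snn_avoid.
apply: le_iter_iint; first exact: snn_cat snn_avoid.
  by apply: snnM; [apply: snn_cst; rewrite lee_fin avoid_ge0|exact: snn_avoid].
by move=> u _; rewrite -EFinM lee_fin mulrC avoid_cat.
Qed.

(** With the last [k] coordinates fixed, integrating the first [n] gives at most [avoidP n] times
    [avoid] of the fixed tail; the tail is then integrated. *)
Lemma avoidP_submul n k : avoidP (n + k) <= avoidP n * avoidP k.
Proof.
rewrite -lee_fin EFinM !avoidPE addnC iterD.
rewrite -iter_iintZ; [|exact: snn_avoid|exact: (snn_iter n snn_avoid).2].
apply: le_iter_iint; first exact: snn_iter snn_avoid.
  by apply: snnM snn_avoid; apply: snn_cst; exact: (snn_iter n snn_avoid).2.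
by move=> u _; rewrite -avoidPE muleC; exact: iter_avoid_le.
Qed.

Lemma avoidP_short n : (n <= m)%N -> avoidP n = 1.
Proof.
move=> nm; apply: EFin_inj; rewrite avoidPE -[RHS](iter_iint_cst n [::] (@lee01 R)).
by apply: eq_iter_iint => u; rewrite addn0 => su; rewrite avoid_short ?su.
Qed.

(** Boolean form of [avoid] with window starts listed explicitly, to match the quantifier over
    ['I_(n - m)] in [alpha]; truncated subtraction leaves no start in a short list. *)
Definition avoidb s :=
  all (fun j => wnd (drop j s) == 1) (iota 0 (size s - m)).

Lemma avoid_avoidb s : avoid s = (avoidb s)%:R.
Proof.
elim: s => //= t s ->; rewrite /avoidb /=.
case: ifP => [ms|/negbT]; last first.
  rewrite -ltnNge => sm.
  by rewrite mul1r (eqP (_ : size s - m == 0)%N) ?subn_eq0 ?(ltnW sm)//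
     (eqP (_ : (size s).+1 - m == 0)%N) ?subn_eq0.
rewrite subSn//= (iotaDl 1 0) all_map /preim/=.
by case: (wnd01 (t :: s)) => ->; rewrite ?eqxx ?mul1r// eq_sym oner_eq0 mul0r.
Qed.

Section symmetrization.
Context (n : nat) (x : n.-tuple R) (ux : uniq x).
Let xI : injective (tnth x).
Proof. by apply/tuple_uniqP. Qed.

(** Reading [x] in the order [p] gives a word with the relative order of [p * Pi (tnth x)], since a
    product of permutations applies its left factor first. *)
Lemma avoidb_pact (p : 'S_n) : avoidb (pact p x) =
  [forall j : 'I_(n - m), Pi (window (p * Pi (tnth x))%g j) \notin S].
Proof.
have wE (j : 'I_(n - m)) : (wnd (drop j (pact p x)) == 1) =
    (Pi (window (p * Pi (tnth x))%g j) \notin S).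
  pose y (k : 'I_m.+1) := tnth x (p (Ordinal (window_subproof j k))).
  have yI : injective y.
    by move=> k l /xI/perm_inj/(congr1 val)/= /addnI/val_inj.
  have -> : wnd (drop j (pact p x)) = chi S (mktuple y).
    rewrite /wnd; congr chi; apply: eq_from_tnth => k; rewrite !tnth_mktuple nth_drop.
    have /= -> := nth_pact p x (Ordinal (window_subproof j k)).
    by rewrite -tnth_nth.
  have -> : Pi (window (p * Pi (tnth x))%g j) = Pi (tnth (mktuple y)).
    apply: Pi_unique; first by move=> k l; rewrite !tnth_mktuple; exact: yI.
    move=> k l; rewrite PiP; last first.
      by move=> a b; rewrite /window => /val_inj/perm_inj/(congr1 val)/= /addnI/val_inj.
    by rewrite /window !permM ltEnat/= PiP// !tnth_mktuple.
  rewrite /chi; have -> : uniq (mktuple y).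
    by apply/tuple_uniqP => k l; rewrite !tnth_mktuple; exact: yI.
  by case: (_ \notin S); [exact: eqxx|rewrite [LHS]eq_sym oner_eq0].
rewrite /avoidb size_tuple; apply/allP/forallP => [xS j|xS j].
  by rewrite -wE; apply: xS; rewrite mem_iota/=.
by rewrite mem_iota => /andP[_ jn]; have := xS (Ordinal jn); rewrite -wE.
Qed.

(** Right multiplication by [Pi (tnth x)] permutes ['S_n], so the sum over all rearrangements no
    longer depends on [x]. *)
Lemma sum_avoid_pact : \sum_(p : 'S_n) avoid (pact p x) = (alpha S n)%:R.
Proof.
under eq_bigr do rewrite avoid_avoidb avoidb_pact.
rewrite (reindex_inj (mulIg (Pi (tnth x))^-1%g))/=.
under eq_bigr do rewrite mulgKV.
rewrite /alpha -sum1_card natr_sum [RHS]big_mkcond/=.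
by apply: eq_bigr => p _; rewrite inE; case: ifP.
Qed.

End symmetrization.

(** Invariance of the cube under permutations turns [n!] times the integral into the integral of the
    sum over all rearrangements, which is the constant [alpha S n] off the null set of repeated
    coordinates. *)
Lemma avoidP_alpha n : avoidP n = (alpha S n)%:R / n`!%:R.
Proof.
apply: (@mulIf _ n`!%:R); first by rewrite pnatr_eq0 -lt0n fact_gt0.
rewrite divfK ?pnatr_eq0 -?lt0n ?fact_gt0//.
apply: EFin_inj.
have h p := @snn_pact R n p _ snn_avoid.
have h' : snn (fun s : seq R => \sum_(p : 'S_n) (avoid (pact p s))%:E)%E.
  split=> [k|u]; last by apply: sume_ge0 => j _; exact: (h j).2.
  by apply: emeasurable_sum => j; exact: (h j).1.
transitivity (iter n (@iint R) (fun s => \sum_(p : 'S_n) (avoid (pact p s))%:E)%E [::]).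
  rewrite iter_iint_sum//.
  under eq_bigr do rewrite (invariant_permT _ snn_avoid) -avoidPE.
  rewrite sumEFin sumr_const card_Sn; congr EFin.
  by rewrite mulr_natr.
have := iter_iint_uniq n [::] h'; rewrite /iuniq/= mule1 => <-.
transitivity (iter n (@iint R) (fun s => (alpha S n)%:R%:E * iuniq s)%E [::]).
  apply: eq_iter_iint => u; rewrite addn0 => su.
  rewrite /iuniq; case uu : (uniq u); last by rewrite !mule0.
  rewrite !mule1 sumEFin; congr EFin.
  by have := @sum_avoid_pact n (Tuple (introT eqP su)) uu; apply.
rewrite iter_iint_uniq ?iter_iint_cst ?/iuniq ?mule1 ?lee_fin//.
by apply: snn_cst; rewrite lee_fin.
Qed.

End avoidance.

(** * Growth rate of a submultiplicative sequence *)

Section submultiplicative.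
Context (R : realType) (a : nat -> R).
Hypotheses (a_ge0 : forall n, 0 <= a n) (a_le1 : forall n, a n <= 1).
Hypotheses (a0 : a 0 = 1) (aM : forall n k, a (n + k)%N <= a n * a k).

(** This is the Fekete limit, the infimum of the roots [a n ^ (1/n)] over [n > 0], written without
    roots. Admitting [n = 0] would let in every [r], as soon as [a 0 <= 1]. *)
Definition growth := inf [set r : R | 0 <= r /\ exists2 n, (0 < n)%N & a n <= r ^+ n].

Let growth_has_inf : has_inf [set r : R | 0 <= r /\ exists2 n, (0 < n)%N & a n <= r ^+ n].
Proof.
split; last by exists 0 => r [].
by exists 1; split => //; exists 1%N; rewrite ?expr1n.
Qed.

Lemma growth_ge0 : 0 <= growth.
Proof. by apply: lb_le_inf growth_has_inf.1 _ => r []. Qed.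

Lemma growth_le n : growth ^+ n <= a n.
Proof.
case: n => [|n]; first by rewrite a0.
have rE : (a n.+1 `^ n.+1%:R^-1) ^+ n.+1 = a n.+1.
  by rewrite -powR_mulrn ?powR_ge0// -powRrM mulVf ?powRr1.
rewrite -[leRHS]rE lerXn2r ?nnegrE ?growth_ge0 ?powR_ge0//.
apply: ge_inf growth_has_inf.2 _ _; split; first exact: powR_ge0.
by exists n.+1; rewrite ?rE.
Qed.

Lemma lt_growth r : growth < r -> exists2 C, 0 < C & forall n, a n <= C * r ^+ n.
Proof.
move=> /(inf_lt growth_has_inf.1)[s [s0 [q q0 aq]] sr].
have r0 : 0 < r by apply: le_lt_trans sr.
have ar : a q <= r ^+ q by apply: le_trans aq _; rewrite lerXn2r ?nnegrE// ltW.
have aX d : a (d * q)%N <= a q ^+ d.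
  elim: d => [|d IH]; first by rewrite mul0n a0.
  by rewrite mulSn exprS; apply: le_trans (aM _ _) _; rewrite ler_wpM2l.
(* For [n = d * q + e] one gets [a n <= r ^ (d * q)], which is [r ^ n] times [r ^ - e]; the constant
   sums these factors over all remainders [e < q]. *)
exists (\sum_(e < q) (r ^+ e)^-1).
  case: q q0 {aq ar aX} => // q _.
  rewrite big_ord_recl ltr_pwDl ?invr_gt0 ?exprn_gt0 ?sumr_ge0// => i _.
  by rewrite invr_ge0 exprn_ge0// ltW.
move=> n; rewrite {1}(divn_eq n q); apply: le_trans (aM _ _) _.
apply: (@le_trans _ _ (r ^+ (n %/ q * q))).
  apply: (@le_trans _ _ (a (n %/ q * q)%N)); first by rewrite ler_piMr.
  by apply: le_trans (aX _) _; rewrite mulnC exprM lerXn2r ?nnegrE// exprn_ge0// ltW.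
have eq := ltn_pmod n q0.
rewrite {2}(divn_eq n q) exprD mulrCA ler_peMr ?exprn_ge0 ?(ltW r0)//.
rewrite (bigD1 (Ordinal eq))//= mulrDl mulVf ?gt_eqF ?exprn_gt0//.
rewrite lerDl mulr_ge0 ?exprn_ge0 ?(ltW r0)// sumr_ge0// => i _.
by rewrite invr_ge0 exprn_ge0// ltW.
Qed.

Lemma cvg_growth : a n `^ n%:R^-1 @[n --> \oo] --> growth.
Proof.
apply/cvgrPdist_le => e e0.
(* An intermediate rate: [a n <= C * r ^ n], and the constant [C] is absorbed because
   [C * (r / (growth + e)) ^ n] is eventually at most 1. *)
set r := growth + e / 2.
have rL : growth < r by rewrite ltrDl divr_gt0.
have r0 : 0 < r by apply: le_lt_trans rL; exact: growth_ge0.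
have re : r < growth + e by rewrite /r ltrD2l ltr_pdivrMr// ltr_pMr// ltr1n.
have [C C0 aC] := lt_growth rL.
have q1 : `|r / (growth + e)| < 1.
  by rewrite ger0_norm ?ltr_pdivrMr ?mul1r ?(lt_trans r0)// divr_ge0 ?ltW// (lt_trans r0).
have /cvgrPdist_le/(_ 1 ltr01) := cvg_geometric C q1.
(* The successor makes [n] positive, so that [n]-th powers undo the root. *)
move=> [N _ NP]; exists N.+1 => // n /= Nn.
have n0 : (0 < n)%N by case: n Nn.
have ge : growth <= a n `^ n%:R^-1.
  rewrite -(@ler_pXn2r _ n)// ?nnegrE ?growth_ge0 ?powR_ge0//.
  rewrite -[leRHS]powR_mulrn ?powR_ge0// -powRrM mulVf ?powRr1 ?growth_le//.
  by rewrite pnatr_eq0 -lt0n.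
rewrite distrC ger0_norm ?subr_ge0// lerBlDl.
rewrite -(@ler_pXn2r _ n)// ?nnegrE ?powR_ge0 ?(ltW (lt_trans r0 re))//.
rewrite -[leLHS]powR_mulrn ?powR_ge0// -powRrM mulVf ?powRr1; last 2 first.
  by [].
  by rewrite pnatr_eq0 -lt0n.
apply: le_trans (aC n) _.
have := NP n (ltnW Nn); rewrite /= /geometric /= sub0r normrN ger0_norm; last first.
  by rewrite mulr_ge0 ?(ltW C0)// exprn_ge0// divr_ge0 ?ltW// (lt_trans r0).
by rewrite expr_div_n mulrA ler_pdivrMr ?mul1r// exprn_gt0// (lt_trans r0).
Qed.

End submultiplicative.

(** * Real integrals over the unit interval *)

Section unit_interval.
Context (R : realType).
Local Notation mR := (measurableTypeR R).
Local Notation I01 := (`[0%R, 1%R]%classic : set mR).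
Local Notation mu := (@lebesgue_measure R).
Implicit Types (h k : seq R -> R) (s u : seq R).

Lemma iintE (h : seq R -> \bar R) s : snn h ->
  iint h s = (\int[mu]_(t in I01) h (t :: s))%E.
Proof.
move=> [mh h0]; rewrite /iint integral_uniform//; last exact: smf_section.
by rewrite subr0 invr1 mul1e.
Qed.

Lemma snn_norm h : smf (h : _ -> mR) -> snn (fun s => `|h s|%:E).
Proof.
move=> mh; split=> [n|s]; last by rewrite lee_fin.
by apply/measurable_EFinP; apply: measurableT_comp => //; exact: mh.
Qed.

Lemma smfB h k : smf (h : _ -> mR) -> smf (k : _ -> mR) -> smf (fun s => h s - k s : mR).
Proof. by move=> mh mk n; exact: measurable_funB (mh n) (mk n). Qed.

Lemma smfD h k : smf (h : _ -> mR) -> smf (k : _ -> mR) -> smf (fun s => h s + k s : mR).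
Proof. by move=> mh mk n; exact: measurable_funD (mh n) (mk n). Qed.

Lemma smfM h k : smf (h : _ -> mR) -> smf (k : _ -> mR) -> smf (fun s => h s * k s : mR).
Proof. by move=> mh mk n; exact: measurable_funM (mh n) (mk n). Qed.

Definition rint h s : R := \int[mu]_(t in I01) h (t :: s).

Lemma integrable_section h s : smf (h : _ -> mR) ->
  mu.-integrable I01 (EFin \o (fun t => h (t :: s))) <-> (iint (fun s => `|h s|%:E) s < +oo)%E.
Proof.
move=> mh; rewrite iintE; last exact: snn_norm.
split=> [/integrableP[]//|hoo]; apply/integrableP; split => //.
apply/measurable_EFinP; apply: measurable_funTS; exact: (smf_section s mh).
Qed.

(** A measurable function with finite extended integral is integrable; otherwise that integral is
    infinite and [fine] sends it to 0. *)
Lemma rint_nonintegrable h s : smf (h : _ -> mR) ->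
  ~ mu.-integrable I01 (EFin \o (fun t => h (t :: s))) -> rint h s = 0.
Proof.
move=> mh nh; rewrite /rint /Rintegral.
have mh' : measurable_fun I01 (fun t : mR => h (t :: s)).
  by apply: measurable_funTS; exact: (smf_section s mh).
case E : (\int[mu]_(t in I01) (h (t :: s))%:E)%E => [r| |]//.
exfalso; apply: nh; apply/integrableP; split; first exact/measurable_EFinP.
by rewrite (integral_fin_num_abs _ _ mh')// E.
Qed.

Lemma smfN h : smf (h : _ -> mR) -> smf (fun s => - h s : mR).
Proof. by move=> mh n; apply: measurableT_comp => //; exact: mh. Qed.

Lemma snn_pos_part h : smf (h : _ -> mR) -> snn (fun s => (Num.max (h s) 0)%:E).
Proof.
move=> mh; split=> [n|u]; last by rewrite lee_fin le_max lexx orbT.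
by apply/measurable_EFinP; apply: measurable_maxr; [exact: mh|exact: measurable_cst].
Qed.

(** Positive and negative parts express [rint] by Tonelli integrals, hence measurably in [s],
    including where the section is not integrable. *)
Lemma rintE h s : smf (h : _ -> mR) -> rint h s =
  fine (iint (fun s => (Num.max (h s) 0)%:E) s - iint (fun s => (Num.max (- h s) 0)%:E) s)%E.
Proof.
move=> mh; rewrite !iintE; [|exact: snn_pos_part (smfN mh)|exact: snn_pos_part].
rewrite /rint /Rintegral integralE; congr (fine (_ - _)).
  by apply: eq_integral => t _; rewrite funeposE EFin_max.
by apply: eq_integral => t _; rewrite funenegE EFin_max.
Qed.

Lemma smf_rint h : smf (h : _ -> mR) -> smf (rint h : _ -> mR).
Proof.
move=> mh n; rewrite (funext (fun s => rintE s mh)).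
apply: (@measurableT_comp _ _ _ _ _ _ fine) => //.
apply: emeasurable_funB; first exact: (snn_iint (snn_pos_part mh)).1.
exact: (snn_iint (snn_pos_part (smfN mh))).1.
Qed.

(* This holds at every [s], not only almost everywhere, because the real-valued
   integral of a non-integrable function is 0. *)
Lemma rint_dist h k s : smf (h : _ -> mR) -> smf (k : _ -> mR) ->
  (`|rint h s - rint k s|%:E <= iint (fun s => `|h s - k s|%:E) s)%E.
Proof.
move=> mh mk.
have [hkoo|] := ltP (iint (fun s => `|h s - k s|%:E) s) +oo%E; last first.
  by rewrite leye_eq => /eqP ->; rewrite leey.
have /(integrable_section _ (smfB mh mk)) ihk := hkoo.
have [ih|nih] := pselect (mu.-integrable I01 (EFin \o (fun t => h (t :: s)))); last first.
  have nik : ~ mu.-integrable I01 (EFin \o (fun t => k (t :: s))).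
    contradict nih.
    have := integrableD _ ihk nih.
    rewrite (_ : _ \+ _ = EFin \o (fun t => h (t :: s)))%E; first exact.
    by apply/funext => t /=; rewrite -EFinD subrK.
  rewrite !rint_nonintegrable// subrr normr0.
  by apply: iint_ge0 => u; rewrite lee_fin.
have ik : mu.-integrable I01 (EFin \o (fun t => k (t :: s))).
  have := integrableB _ ih ihk.
  rewrite (_ : (fun _ => _) = EFin \o (fun t => k (t :: s)))%E; first exact.
  by apply/funext => t /=; rewrite -EFinB opprB addrC subrK.
rewrite -RintegralB// iintE; last exact: snn_norm (smfB mh mk).
apply: le_trans (_ : (\int[mu]_(t in I01) `|h (t :: s) - k (t :: s)|)%:E <= _)%E.
  by rewrite lee_fin; apply: le_normr_Rintegral.
rewrite /Rintegral fineK//.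
have /integrableP[_] := ihk.
by rewrite ge0_fin_numE//; exact: integral_ge0.
Qed.

Lemma rint_linear h k c s : smf (h : _ -> mR) -> smf (k : _ -> mR) ->
  (iint (fun s => `|h s|%:E) s < +oo)%E -> (iint (fun s => `|k s|%:E) s < +oo)%E ->
  rint (fun s => c * h s + k s) s = c * rint h s + rint k s.
Proof.
move=> mh mk /(integrable_section _ mh) ih /(integrable_section _ mk) ik.
rewrite /rint RintegralD//; first by rewrite RintegralZl.
have := integrableZl _ c ih; apply.
exact: measurable_itv.
Qed.

Lemma snn_sqr h : smf (h : _ -> mR) -> snn (fun s => (h s ^+ 2)%:E).
Proof.
move=> mh; split=> [n|u]; last by rewrite lee_fin sqr_ge0.
by apply/measurable_EFinP; apply: measurable_funX; exact: mh.
Qed.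

(* AM-GM: [2 p |h| <= h^2 + p^2]. *)
Lemma L1_sqr_le h n s (p : R) : smf (h : _ -> mR) -> 0 <= p ->
  (p%:E <= iter n iint (fun s => `|h s|%:E) s)%E ->
  ((p ^+ 2)%:E <= iter n iint (fun s => (h s ^+ 2)%:E) s)%E.
Proof.
move=> mh p0 hp.
have m2 := snn_sqr mh.
have pp : (0 <= (p ^+ 2)%:E)%E by rewrite lee_fin sqr_ge0.
suff : ((2 * p)%:E * p%:E <= iter n iint (fun s => (h s ^+ 2)%:E) s + (p ^+ 2)%:E)%E.
  rewrite -leeBlDr// -EFinM -EFinB; apply: le_trans.
  by rewrite lee_fin (_ : _ - _ = p ^+ 2)//; ring.
have e2p : (0 <= (2 * p)%:E)%E by rewrite lee_fin mulr_ge0.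
apply: le_trans (lee_pmul _ _ (lexx _) hp) _ => //.
rewrite -(iter_iintZ n s (snn_norm mh) e2p) -(iter_iint_cst n s pp).
rewrite -(iter_iintD n s m2 (snn_cst pp)).
apply: le_iter_iint.
- by apply: snnM (snn_norm mh); exact: snn_cst.
- by apply: snnD => //; exact: snn_cst.
move=> t _; rewrite -EFinM -EFinD lee_fin.
rewrite -subr_ge0 -[h _ ^+ 2](ger0_norm (sqr_ge0 _)) normrX.
by rewrite (_ : _ - _ = (`|h t| - p) ^+ 2) ?sqr_ge0//; ring.
Qed.

Lemma rint_sqr_le h s : smf (h : _ -> mR) ->
  ((rint h s ^+ 2)%:E <= iint (fun s => (h s ^+ 2)%:E) s)%E.
Proof.
move=> mh; have hp : (`|rint h s|%:E <= iint (fun s => `|h s|%:E) s)%E.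
  have := @rint_dist h (cst 0) s mh (fun n => measurable_cst _).
  rewrite {2}/rint /= Rintegral_cst// mul0r subr0.
  by under [X in iint X]eq_fun do rewrite subr0.
have := L1_sqr_le (n := 1) mh (normr_ge0 _) hp.
by rewrite real_normK ?num_real.
Qed.

End unit_interval.

(** * The pattern operator on lists *)

Section pattern_operator.
Context (R : realType) (m : nat) (S : {set 'S_m.+1}).
Local Notation mR := (measurableTypeR R).
Local Notation wnd := (wnd S).
Local Notation avoidP := (@avoidP R m S).

(** The extended operator needs only nonnegativity and dominates its real counterpart [wop], so size
    estimates are made on it. On lists the last coordinate is not dropped as in [Top]: functions of
    the first [m] entries do not see it. *)
Definition ewop (h : seq R -> \bar R) s := iint (fun s => (wnd s)%:E * h s)%E s.

Definition wop (h : seq R -> R) s : R := rint (fun s => wnd s * h s) s.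

Lemma snn_wM (h : seq R -> \bar R) : snn h -> snn (fun s => (wnd s)%:E * h s)%E.
Proof. by move=> hh; apply: snnM => //; exact: snn_wnd. Qed.

Lemma snn_ewop n h : snn h -> snn (iter n ewop h).
Proof. by move=> hh; elim: n => //= n IH; apply/snn_iint/snn_wM. Qed.

Lemma smf_wop n h : smf (h : _ -> mR) -> smf (iter n wop h : _ -> mR).
Proof.
move=> hh; elim: n => //= n IH; apply: smf_rint; apply: smfM => //.
exact: smf_wnd.
Qed.

Lemma le_iter_ewop h k n s : snn h -> snn k ->
  (forall u, (size u = n + size s)%N -> (h u <= k u)%E) ->
  (iter n ewop h s <= iter n ewop k s)%E.
Proof.
move=> hh kk; elim: n s => [|n IH] s hk; first exact: hk.
rewrite !iterS; apply: le_iint => [||t]; try exact/snn_wM/snn_ewop.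
apply: lee_wpmul2l; first by rewrite lee_fin wnd_ge0.
by apply: IH => u /= su; apply: hk; rewrite su addnS.
Qed.

Lemma iter_ewop_le h n s : snn h -> (iter n ewop h s <= iter n iint h s)%E.
Proof.
move=> hh; elim: n s => // n IH s.
rewrite !iterS; apply: le_iint => [||t]; [exact/snn_wM/snn_ewop|exact: snn_iter|].
apply: le_trans (IH _); rewrite -[leRHS]mul1e; apply: lee_wpmul2r.
  exact: (snn_ewop n hh).2.
by rewrite lee_fin wnd_le1.
Qed.

Lemma iter_ewopZ h c n s : snn h -> (0 <= c)%E ->
  iter n ewop (fun s => c * h s)%E s = (c * iter n ewop h s)%E.
Proof.
move=> hh c0; elim: n s => // n IH s; rewrite !iterS /ewop.
have := iter_iintZ 1 s (snn_wM (snn_ewop n hh)) c0 => /= <-.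
congr iint; apply/funext => u; by rewrite IH muleCA.
Qed.

(* Each window of a list longer than [m] is either read by the operator while
   integrating or already lies in the remaining tail. *)
Lemma iter_ewop_avoid h n s : snn h -> (m <= size s)%N ->
  iter n iint (fun u => h u * (avoid S u)%:E)%E s =
  (iter n ewop h s * (avoid S s)%:E)%E.
Proof.
elim: n h => // n IH h hh ms.
rewrite !iterSr -IH//; last exact: (snn_ewop 1 hh).
apply: eq_iter_iint => u su.
have mu : (m <= size u)%N by rewrite su (leq_trans ms)// leq_addl.
rewrite /ewop [RHS]muleC.
have a0 : (0 <= (avoid S u)%:E)%E by rewrite lee_fin avoid_ge0.
have := iter_iintZ 1 u (snn_wM hh) a0 => /= <-.
apply: eq_integral => t _ /=.
by rewrite mu EFinM muleA [in RHS]muleC [(h _ * _)%E]muleC.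
Qed.

Lemma iter_ewop1 n s : size s = m ->
  iter n ewop (cst 1%E) s = iter n iint (fun u => (avoid S u)%:E) s.
Proof.
move=> sm; have := @iter_ewop_avoid (cst 1%E) n s (snn_cst lee01).
rewrite sm leqnn avoid_short ?sm// mule1 => <-//.
by apply: eq_iter_iint => u _; rewrite mul1e.
Qed.

Lemma iter_ewop1_le n s : size s = m -> (iter n ewop (cst 1%E) s <= (avoidP n)%:E)%E.
Proof.
move=> sm; rewrite iter_ewop1//; apply: le_trans (iter_avoid_le _ _ _) _.
by rewrite avoid_short ?sm// mul1e.
Qed.

Lemma avoidP_ewop n : (avoidP (n + m))%:E = iter m iint (iter n ewop (cst 1%E)) [::].
Proof.
rewrite avoidPE addnC iterD; apply: eq_iter_iint => u; rewrite addn0 => um.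
by rewrite iter_ewop1.
Qed.

Lemma wop_dist h k n s : smf (h : _ -> mR) -> smf (k : _ -> mR) ->
  (`|iter n wop h s - iter n wop k s|%:E <= iter n ewop (fun s => `|h s - k s|%:E) s)%E.
Proof.
move=> mh mk; elim: n s => // n IH s; rewrite !iterS.
have mW l : smf (l : _ -> mR) -> smf (fun s => wnd s * l s : mR).
  by move=> ml; exact: smfM (@smf_wnd R m S) ml.
apply: le_trans (rint_dist _ (mW _ (smf_wop n mh)) (mW _ (smf_wop n mk))) _.
apply: le_iint => [||t].
- by apply: snn_norm; apply: smfB; apply: mW; exact: smf_wop.
- by apply/snn_wM/snn_ewop/snn_norm; exact: smfB.
rewrite -mulrBr normrM (ger0_norm (wnd_ge0 _ _)) EFinM.
by apply: lee_wpmul2l; [rewrite lee_fin wnd_ge0|exact: IH].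
Qed.

Lemma wop0 n s : iter n wop (cst 0) s = 0.
Proof.
elim: n s => // n IH s; rewrite iterS /wop /rint.
under eq_Rintegral do rewrite IH mulr0.
by rewrite Rintegral_cst// mul0r.
Qed.

Lemma wop_norm h n s : smf (h : _ -> mR) ->
  (`|iter n wop h s|%:E <= iter n ewop (fun s => `|h s|%:E) s)%E.
Proof.
move=> mh; have := @wop_dist h (cst 0) n s mh (fun n => measurable_cst _).
by rewrite wop0 subr0; under [X in iter n ewop X]eq_fun do rewrite subr0.
Qed.

Lemma wop_linear h k c s : smf (h : _ -> mR) -> smf (k : _ -> mR) ->
  (iint (fun s => `|h s|%:E) s < +oo)%E -> (iint (fun s => `|k s|%:E) s < +oo)%E ->
  wop (fun s => c * h s + k s) s = c * wop h s + wop k s.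
Proof.
move=> mh mk hoo koo.
have mW l : smf (l : _ -> mR) -> smf (fun s => wnd s * l s : mR).
  by move=> ml; exact: smfM (@smf_wnd R m S) ml.
have Woo l : smf (l : _ -> mR) -> (iint (fun s => `|l s|%:E) s < +oo)%E ->
    (iint (fun s => `|wnd s * l s|%:E) s < +oo)%E.
  move=> ml; apply: le_lt_trans; apply: le_iint => [||t].
  - exact: snn_norm (mW _ ml).
  - exact: snn_norm.
  by rewrite lee_fin normrM (ger0_norm (wnd_ge0 _ _)) ler_piMl// wnd_le1.
rewrite /wop -rint_linear; [|exact: mW|exact: mW|exact: Woo|exact: Woo].
by congr rint; apply/funext => u; ring.
Qed.

Definition dep {X} j (F : seq R -> X) :=
  forall s u, (forall i, (i < j)%N -> s`_i = u`_i) -> F s = F u.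

Lemma dep_iter_iint j k F : dep (j + k) F -> dep j (iter k iint F).
Proof.
elim: k j => [|k IH] j dF; first by rewrite addn0 in dF.
rewrite addnS -addSn in dF; have {}IH := IH _ dF.
move=> s u su; rewrite !iterS; apply: eq_integral => t _; apply: IH => -[|i]//=.
by rewrite ltnS; exact: su.
Qed.

Lemma dep_iint_cst F s : dep m F -> iter m iint F s = iter m iint F [::].
Proof. by move=> dF; apply: (@dep_iter_iint 0 m). Qed.

(** After [m] integrations [F] has become a constant, which one more average over [[0, 1]]
    preserves. Thus averaging over the new first coordinate keeps the mean on the cube. *)
Lemma iint_dep_stable F : dep m F -> iter m iint (iint F) [::] = iter m iint F [::].
Proof.
move=> dF; rewrite -iterSr iterS /iint.
under eq_integral do rewrite dep_iint_cst//.
have [F0|F0] := leP 0%E (iter m iint F [::]).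
  exact: (iter_iint_cst 1 [::] F0).
rewrite integral_cst// [X in (_ * X)%E](_ : _ = 1%E) ?mule1//.
exact: (@probability_setT _ _ _ (uniform_prob (@ltr01 R))).
Qed.

(** The innermost [m] applications, with their weights bounded by 1, replace [F] by its mean over
    the cube; the other [j] act on a constant. *)
Lemma iter_ewop_bound F j s : snn F -> dep m F -> size s = m ->
  (iter (j + m) ewop F s <= iter m iint F [::] * (avoidP j)%:E)%E.
Proof.
move=> hF dF sm; rewrite iterD.
have F0 : (0 <= iter m iint F [::])%E by exact: (snn_iter m hF).2.
apply: le_trans (_ : iter j ewop (fun u => iter m iint F [::] * cst 1 u)%E s <= _)%E.
  apply: le_iter_ewop; first exact: snn_ewop.
    by apply: snnM; [exact: snn_cst|exact: snn_cst].
  by move=> u _; rewrite mule1 -(dep_iint_cst u dF); exact: iter_ewop_le.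
rewrite iter_ewopZ//; last exact: snn_cst.
by apply: lee_wpmul2l => //; exact: iter_ewop1_le.
Qed.

(** Jensen's inequality moves the square inside the integral, the weight is at most 1, and averaging
    in the first variable preserves the mean: [T] is a contraction of [L^2]. *)
Lemma wop_sqr_le h : smf (h : _ -> mR) -> dep m h ->
  (iter m iint (fun s => (wop h s ^+ 2)%:E) [::] <=
   iter m iint (fun s => (h s ^+ 2)%:E) [::])%E.
Proof.
move=> mh dh.
have m2 l : smf (l : _ -> mR) -> snn (fun s => (l s ^+ 2)%:E).
  move=> ml; split=> [n|u]; last by rewrite lee_fin sqr_ge0.
  by apply/measurable_EFinP; apply: measurable_funX; exact: ml.
have mW : smf (fun s => wnd s * h s : mR) by exact: smfM (@smf_wnd R m S) mh.
rewrite -[leRHS]iint_dep_stable; last by move=> s u /dh ->.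
apply: le_iter_iint; first exact: m2 (smf_wop 1 mh).
  exact: snn_iint (m2 _ mh).
move=> u _; apply: le_trans (rint_sqr_le _ mW) _; apply: le_iint => [||t].
- exact: m2.
- exact: m2.
rewrite lee_fin exprMn ler_piMl ?sqr_ge0// expr_le1 ?wnd_ge0 ?wnd_le1//.
Qed.

Definition ext {X} (f : m.-tuple R -> X) s := f [tuple s`_i | i < m].

Lemma ext_tuple {X} (f : m.-tuple R -> X) (x : m.-tuple R) : ext f x = f x.
Proof.
by congr f; apply: eq_from_tnth => i; rewrite tnth_mktuple -tnth_nth.
Qed.

Lemma dep_ext {X} (f : m.-tuple R -> X) : dep m (ext f).
Proof.
by move=> s u su; congr f; apply: eq_from_tnth => i; rewrite !tnth_mktuple su.
Qed.

Lemma smf_ext d (Y : measurableType d) (f : m.-tuple R -> Y) :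
  measurable_fun setT (f : m.-tuple mR -> Y) -> smf (ext f).
Proof. by move=> mf; exact: (smf_tuple (fun i => i) mf). Qed.

Lemma integral_cube_ext (f : m.-tuple R -> \bar R) :
  measurable_fun setT (f : m.-tuple mR -> \bar R) -> (forall x, 0 <= f x)%E ->
  (\int[cube R m]_x f x = iter m iint (ext f) [::])%E.
Proof.
move=> mf f0; rewrite -integral_cube; last by split=> [|s]; [exact: smf_ext|exact: f0].
by apply: eq_integral => x _; rewrite ext_tuple.
Qed.

Lemma Top_wop (f : m.-tuple R -> R[i]) s :
  ext (Top S f) s = Complex (wop (fun u => complex.Re (ext f u)) s)
                            (wop (fun u => complex.Im (ext f u)) s).
Proof.
rewrite {1}/ext /Top /Cintegral /wop /rint.
have E t : [tuple ([tuple of t :: [tuple s`_i | i < m]] : seq R)`_i | i < m] =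
    [tuple (t :: s)`_i | i < m].
  apply: eq_from_tnth => -[[|i] im]; rewrite !tnth_mktuple//=.
  by have := nth_wtuple s (Ordinal (ltnW im)).
have W t : chi S [tuple of t :: [tuple s`_i | i < m]] = wnd (t :: s).
  congr chi; apply: eq_from_tnth => -[[|i] im]; rewrite (tnth_nth 0) tnth_mktuple//=.
  by have := nth_wtuple s (Ordinal (im : (i < m)%N)).
congr Complex; apply: eq_Rintegral => t _; rewrite W /ext -E.
  by case: (f _) => a b /=; rewrite mul0r subr0.
by case: (f _) => a b /=; rewrite mul0r addr0.
Qed.

Lemma iter_Top_wop n (f : m.-tuple R -> R[i]) s :
  ext (iter n (Top S) f) s = Complex (iter n wop (fun u => complex.Re (ext f u)) s)
                            (iter n wop (fun u => complex.Im (ext f u)) s).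
Proof.
elim: n s => [|n IH] s; first by rewrite /=; case: (ext f s).
rewrite !iterS Top_wop; congr (Complex (wop _ _) (wop _ _)); apply/funext => u;
  by rewrite IH.
Qed.

Lemma iter_Top n (f : m.-tuple R -> R[i]) (x : m.-tuple R) :
  iter n (Top S) f x = Complex (iter n wop (fun u => complex.Re (ext f u)) x)
                            (iter n wop (fun u => complex.Im (ext f u)) x).
Proof. by rewrite -iter_Top_wop ext_tuple. Qed.

End pattern_operator.

(** * Square-integrable complex functions *)

Section square_modulus.
Context (R : realType).
Implicit Types z w c : R[i].

Definition sqn z : R := complex.Re z ^+ 2 + complex.Im z ^+ 2.

Lemma sqn_ge0 z : 0 <= sqn z.
Proof. by rewrite addr_ge0 ?sqr_ge0. Qed.

Lemma sqnM c z : sqn (c * z) = sqn c * sqn z.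
Proof. by case: c => a b; case: z => x y; rewrite /sqn /=; ring. Qed.

Lemma sqnD z w : sqn (z + w) <= 2 * sqn z + 2 * sqn w.
Proof.
case: z => a b; case: w => x y; rewrite /sqn /= -subr_ge0.
rewrite (_ : _ - _ = (a - x) ^+ 2 + (b - y) ^+ 2); last by ring.
by rewrite addr_ge0 ?sqr_ge0.
Qed.

Lemma normc_sqn z : ComplexField.Normc.normc z = Num.sqrt (sqn z).
Proof. by case: z. Qed.

Lemma normc_sqr z : ComplexField.Normc.normc z ^+ 2 = sqn z.
Proof. by rewrite normc_sqn sqr_sqrtr ?sqn_ge0. Qed.

Lemma Re_lin c z w : complex.Re (c * z + w) =
  complex.Re c * complex.Re z + (- complex.Im c * complex.Im z + complex.Re w).
Proof. by case: c => a b; case: z => x y; case: w => u v /=; ring. Qed.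

Lemma Im_lin c z w : complex.Im (c * z + w) =
  complex.Re c * complex.Im z + (complex.Im c * complex.Re z + complex.Im w).
Proof. by case: c => a b; case: z => x y; case: w => u v /=; ring. Qed.

End square_modulus.

Section L2_theory.
Context d (X : measurableType d) (R : realType) (mu : {measure set X -> \bar R}).
Implicit Types (f g : X -> R[i]) (A B : (X -> R[i]) -> (X -> R[i])).

Definition cmeas f := measurable_fun setT (fun x => complex.Re (f x)) /\
  measurable_fun setT (fun x => complex.Im (f x)).

(** The squared [L^2] norm. Operator bounds are stated with it, so that integrals are compared
    without taking roots. *)
Definition N2 f := (\int[mu]_x (sqn (f x))%:E)%E.

Lemma measurable_sqn f : cmeas f -> measurable_fun setT (fun x => (sqn (f x))%:E).
Proof.
move=> [mr mi]; apply/measurable_EFinP.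
by apply: measurable_funD; apply: measurable_funX.
Qed.

Lemma N2_ge0 f : (0 <= N2 f)%E.
Proof. by apply: integral_ge0 => x _; rewrite lee_fin sqn_ge0. Qed.

Lemma Lfun2P (h : X -> R) : (h \in Lfun mu 2%:E) <->
  measurable_fun setT h /\ (\int[mu]_x (h x ^+ 2)%:E < +oo)%E.
Proof.
have E : (\int[mu]_x `|(h x)%:E| `^ 2 = \int[mu]_x (h x ^+ 2)%:E)%E.
  apply: eq_integral => x _ /=.
  by rewrite powR_mulrn// real_normK ?num_real.
split=> [hL|[mh h2]].
  split; first by have := sub_Lfun_mfun hL; rewrite inE.
  have /integrableP[_] := Lfun2_integrable_sqr hL.
  apply: le_lt_trans; rewrite le_eqVlt; apply/orP; left; apply/eqP.
  by apply: eq_integral => x _ /=; rewrite ger0_norm ?sqr_ge0.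
rewrite inE; apply/andP; split; rewrite inE//=.
by rewrite /finite_norm unlock E poweR_lty.
Qed.

Lemma L2P f : L2 mu f <-> cmeas f /\ (N2 f < +oo)%E.
Proof.
have le (F G : X -> R) : measurable_fun setT F -> measurable_fun setT G ->
    (forall x, 0 <= F x <= G x) ->
    (\int[mu]_x (F x)%:E <= \int[mu]_x (G x)%:E)%E.
  move=> mF mG FG; apply: ge0_le_integral => //; try exact/measurable_EFinP.
  - by move=> x _; rewrite lee_fin; case/andP: (FG x).
  - by move=> x _; rewrite lee_fin; case/andP: (FG x).
rewrite /L2 /=; split.
  move=> [/Lfun2P[mr r2] /Lfun2P[mi i2]]; split=> //.
  rewrite /N2 /sqn; under eq_integral do rewrite EFinD.
  rewrite ge0_integralD//; first exact: lte_add_pinfty.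
  - by move=> x _; rewrite lee_fin sqr_ge0.
  - by apply/measurable_EFinP; exact: measurable_funX.
  - by move=> x _; rewrite lee_fin sqr_ge0.
  - by apply/measurable_EFinP; exact: measurable_funX.
move=> [[mr mi] f2].
have ms : measurable_fun setT (fun x => sqn (f x)).
  by apply: measurable_funD; exact: measurable_funX.
split; apply/Lfun2P; split=> //; apply: le_lt_trans f2; apply: le => //;
  try exact: measurable_funX; move=> x; rewrite sqr_ge0 /sqn.
  by rewrite lerDl sqr_ge0.
by rewrite lerDr sqr_ge0.
Qed.

Lemma L2normE f : L2norm mu f = (N2 f `^ 2^-1)%E.
Proof.
rewrite /L2norm unlock /N2; congr (_ `^ _)%E; apply: eq_integral => x _ /=.
by rewrite powR_mulrn// real_normK ?num_real// normc_sqr.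
Qed.

Lemma L2norm_le M f g : 0 <= M ->
  (L2norm mu f <= M%:E * L2norm mu g)%E <-> (N2 f <= (M ^+ 2)%:E * N2 g)%E.
Proof.
move=> M0.
have N0 f' : (0 <= N2 f')%E := N2_ge0 f'.
have P0 (y : \bar R) : (0 <= y)%E -> y \in `[0, +oo%E]%R by rewrite in_itv/= leey andbT.
have LK f' : (L2norm mu f' `^ 2)%E = N2 f'.
  by rewrite L2normE -poweRrM mulVf// poweRe1.
have MM : (M%:E `^ 2)%E = (M ^+ 2)%:E by rewrite poweR_EFin powR_mulrn.
split=> le.
  rewrite -LK -[in leRHS]LK -MM -poweRM ?lee_fin//; last by rewrite L2normE poweR_ge0.
  apply: gt0_ler_poweR => //; apply: P0; first by rewrite L2normE poweR_ge0.
  by rewrite mule_ge0 ?lee_fin// L2normE poweR_ge0.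
rewrite !L2normE.
have -> : M%:E = ((M ^+ 2)%:E `^ 2^-1)%E.
  by rewrite poweR_EFin -powR_mulrn// -powRrM mulfV// powRr1.
rewrite -poweRM ?lee_fin ?sqr_ge0//.
apply: gt0_ler_poweR => //; apply: P0 => //.
by rewrite mule_ge0// lee_fin sqr_ge0.
Qed.

Lemma bounded_operatorP A : bounded_operator mu A <->
  [/\ (forall f, L2 mu f -> L2 mu (A f)),
      (forall f g, L2 mu f -> L2 mu g -> f = g %[ae mu] -> A f = A g %[ae mu]),
      (forall (c : R[i]) f g, L2 mu f -> L2 mu g ->
        A (fun x => c * f x + g x) = (fun x => c * A f x + A g x) %[ae mu]) &
      exists2 M : R, 0 <= M & forall f, L2 mu f -> (N2 (A f) <= M%:E * N2 f)%E].
Proof.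
split=> -[a1 a2 a3].
  (* The constant in [bounded_operator] may be negative, hence the absolute value before
     squaring. *)
  move=> [M aM]; split=> //; exists (`|M| ^+ 2); first exact: sqr_ge0.
  move=> f f2; apply/L2norm_le => //; apply: le_trans (aM _ f2) _.
  by apply: lee_wpmul2r; [rewrite L2normE poweR_ge0|rewrite lee_fin ler_norm].
move=> [M M0 aM]; split=> //; exists (Num.sqrt M) => f f2.
by apply/L2norm_le; rewrite ?sqrtr_ge0// sqr_sqrtr// aM.
Qed.

Lemma cmeas_lin c f g : cmeas f -> cmeas g -> cmeas (fun x => c * f x + g x).
Proof.
move=> [mf mf'] [mg mg']; split.
  under eq_fun do rewrite Re_lin.
  by apply: measurable_funD; [|apply: measurable_funD] => //; exact: measurable_funM.
under eq_fun do rewrite Im_lin.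
by apply: measurable_funD; [|apply: measurable_funD] => //; exact: measurable_funM.
Qed.

(** Takes the place of Minkowski's inequality, from [|z + w|^2 <= 2 |z|^2 + 2 |w|^2]; the loss of
    constants is harmless for boundedness. *)
Lemma N2_lin c f g : cmeas f -> cmeas g ->
  (N2 (fun x => c * f x + g x)%R <= (2 * sqn c)%:E * N2 f + 2%:E * N2 g)%E.
Proof.
move=> mf mg.
have h0 k (h : X -> R[i]) x : 0 <= k -> (0 <= k%:E * (sqn (h x))%:E)%E.
  by move=> k0; rewrite mule_ge0 ?lee_fin ?sqn_ge0.
have Z k h : 0 <= k -> cmeas h ->
    (k%:E * N2 h = \int[mu]_x (k%:E * (sqn (h x))%:E))%E.
  move=> k0 mh; rewrite /N2 ge0_integralZl//; first exact: measurable_sqn.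
  by move=> x _; rewrite lee_fin sqn_ge0.
have k0 : 0 <= 2 * sqn c by rewrite mulr_ge0 ?sqn_ge0.
have mZ (k : R) h : cmeas h -> measurable_fun setT (fun x => k%:E * (sqn (h x))%:E)%E.
  by move=> mh; apply: measurable_funeM; exact: measurable_sqn.
rewrite !Z// -ge0_integralD//; try exact: mZ; try by move=> x _; exact: h0.
apply: ge0_le_integral => //.
- by move=> x _; rewrite lee_fin sqn_ge0.
- by apply: measurable_sqn; exact: cmeas_lin.
- by apply: emeasurable_funD; exact: mZ.
move=> x _; rewrite -!EFinM -EFinD lee_fin.
by apply: le_trans (sqnD _ _) _; rewrite sqnM mulrA.
Qed.

Lemma L2_lin c f g : L2 mu f -> L2 mu g -> L2 mu (fun x => c * f x + g x).
Proof.
move=> /L2P[mf f2] /L2P[mg g2]; apply/L2P; split; first exact: cmeas_lin.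
apply: le_lt_trans (N2_lin _ mf mg) _.
by apply: lte_add_pinfty; apply: lte_mul_pinfty => //; rewrite lee_fin// mulr_ge0 ?sqn_ge0.
Qed.

Lemma L2_0 : L2 mu (fun _ => 0).
Proof.
apply/L2P; split; first by split; exact: measurable_cst.
rewrite /N2 (eq_integral (cst 0%E)) ?integral0// => x _.
by rewrite /sqn /= expr0n addr0.
Qed.

Lemma bounded_operator_lin c A B : bounded_operator mu A -> bounded_operator mu B ->
  bounded_operator mu (fun f x => c * A f x + B f x).
Proof.
move=> /bounded_operatorP[a1 a2 a3 [M M0 aM]] /bounded_operatorP[b1 b2 b3 [N N0 bN]].
apply/bounded_operatorP; split.
- by move=> f f2; apply: L2_lin; [exact: a1|exact: b1].
- move=> f g f2 g2 fg; have := a2 _ _ f2 g2 fg; have := b2 _ _ f2 g2 fg.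
  by apply: filterS2 => x Bx Ax _; rewrite Ax// Bx.
- move=> k f g f2 g2; have := a3 k _ _ f2 g2; have := b3 k _ _ f2 g2.
  by apply: filterS2 => x Bx Ax _; rewrite Ax// Bx//; ring.
exists (2 * sqn c * M + 2 * N).
  by rewrite addr_ge0 ?mulr_ge0 ?sqn_ge0.
move=> f f2; have /L2P[af _] := a1 _ f2; have /L2P[bf _] := b1 _ f2.
apply: le_trans (N2_lin _ af bf) _.
rewrite [(_ * _ + _)%:E]EFinD [leRHS]ge0_muleDl ?lee_fin ?mulr_ge0 ?sqn_ge0//.
apply: leeD.
  by rewrite [(_ * M)%:E]EFinM -muleA; apply: lee_wpmul2l;
    [rewrite lee_fin mulr_ge0 ?sqn_ge0|exact: aM].
by rewrite [(_ * N)%:E]EFinM -muleA; apply: lee_wpmul2l; [rewrite lee_fin|exact: bN].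
Qed.

Lemma bounded_operator_comp A B : bounded_operator mu A -> bounded_operator mu B ->
  bounded_operator mu (fun f => A (B f)).
Proof.
move=> /bounded_operatorP[a1 a2 a3 [M M0 aM]] /bounded_operatorP[b1 b2 b3 [N N0 bN]].
apply/bounded_operatorP; split.
- by move=> f f2; exact/a1/b1.
- by move=> f g f2 g2 fg; apply: a2; [exact: b1|exact: b1|exact: b2].
- move=> k f g f2 g2.
  have h1 := a2 _ _ (b1 _ (L2_lin k f2 g2)) (L2_lin k (b1 _ f2) (b1 _ g2)) (b3 k _ _ f2 g2).
  have h2 := a3 k _ _ (b1 _ f2) (b1 _ g2).
  by move: h1 h2; apply: filterS2 => x Bx Ax _; rewrite Bx// Ax.
exists (M * N); first by rewrite mulr_ge0.
move=> f f2; apply: le_trans (aM _ (b1 _ f2)) _.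
by rewrite EFinM -muleA; apply: lee_wpmul2l; [rewrite lee_fin|exact: bN].
Qed.

Lemma bounded_operator0 : bounded_operator mu (fun _ _ => 0).
Proof.
apply/bounded_operatorP; split.
- by move=> *; exact: L2_0.
- by move=> *; apply: nearW => x.
- by move=> *; apply: nearW => x _; rewrite mulr0 addr0.
exists 0 => // f f2; rewrite mul0e /N2 (eq_integral (cst 0%E)) ?integral0// => x _.
by rewrite /sqn /= expr0n addr0.
Qed.

Lemma bounded_operator_id : bounded_operator mu id.
Proof.
apply/bounded_operatorP; split => //; first by move=> *; exact: nearW.
by exists 1 => // f f2; rewrite mul1e.
Qed.

Lemma bounded_operator_iter n A : bounded_operator mu A -> bounded_operator mu (iter n A).
Proof.
move=> bA; elim: n => [|n IH]; first exact: bounded_operator_id.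
exact: (bounded_operator_comp bA IH).
Qed.

End L2_theory.

(** * Boundedness of the pattern operator *)

Section Top_bounded.
Context (R : realType) (m : nat) (S : {set 'S_m.+1}).
Local Notation mR := (measurableTypeR R).
Local Notation mu := (cube R m).
Local Notation wop := (wop S).
Local Notation ewop := (@ewop R m S).
Implicit Types (f g : m.-tuple R -> R[i]) (h : seq R -> R).

Definition re f s : R := complex.Re (ext f s).
Definition im f s : R := complex.Im (ext f s).

Lemma dep_re f : dep m (re f).
Proof. by move=> s u su; rewrite /re (dep_ext f su). Qed.

Lemma dep_im f : dep m (im f).
Proof. by move=> s u su; rewrite /im (dep_ext f su). Qed.

Lemma smf_re f : @cmeas _ (m.-tuple mR) R f -> smf (re f : _ -> mR).
Proof. by move=> [mf _]; exact: (smf_ext mf). Qed.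

Lemma smf_im f : @cmeas _ (m.-tuple mR) R f -> smf (im f : _ -> mR).
Proof. by move=> [_ mf]; exact: (smf_ext mf). Qed.

Lemma cmeas_Top n f : @cmeas _ (m.-tuple mR) R f ->
  @cmeas _ (m.-tuple mR) R (iter n (Top S) f).
Proof.
move=> mf; split; under eq_fun do rewrite iter_Top /=.
  exact: (smf_wop S n (smf_re mf)).
exact: (smf_wop S n (smf_im mf)).
Qed.

(** Equivalent to the complex [L^1] norm, and additive in the two real functions to which [wop] is
    applied. *)
Definition L1c f : \bar R := (iter m iint (fun s => `|re f s|%:E) [::] +
  iter m iint (fun s => `|im f s|%:E) [::])%E.

Lemma L1_fin h n s : smf (h : _ -> mR) ->
  (iter n iint (fun s => (h s ^+ 2)%:E) s < +oo)%E ->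
  (iter n iint (fun s => `|h s|%:E) s < +oo)%E.
Proof.
move=> mh h2.
(* [|h| <= h^2 + 1], and the constant 1 has finite integral on the cube. *)
apply: le_lt_trans (_ : iter n iint (fun s => (h s ^+ 2)%:E + cst 1 s)%E s < _)%E.
  apply: le_iter_iint; first exact: snn_norm.
    by apply: snnD; [exact: snn_sqr|exact: snn_cst].
  move=> u _; rewrite -EFinD lee_fin.
  have := sqr_ge0 (`|h u| - 1); rewrite sqrrB real_normK ?num_real//.
  by have := normr_ge0 (h u); lra.
rewrite iter_iintD; [|exact: snn_sqr|exact: snn_cst].
by rewrite iter_iint_cst// lte_add_pinfty// ltry.
Qed.

Lemma N2E f : @cmeas _ (m.-tuple mR) R f -> N2 mu f =
  (iter m iint (fun s => (re f s ^+ 2)%:E) [::] +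
   iter m iint (fun s => (im f s ^+ 2)%:E) [::])%E.
Proof.
move=> mf; rewrite /N2 integral_cube_ext.
- by rewrite -iter_iintD//; exact: snn_sqr (smf_re mf) || exact: snn_sqr (smf_im mf).
- exact: measurable_sqn.
- by move=> x; rewrite lee_fin sqn_ge0.
Qed.

Lemma L1c_ge0 f : (0 <= L1c f)%E.
Proof.
have h0 h n s : (0 <= iter n iint (fun s => `|h s|%:E) s :> \bar R)%E.
  by elim: n s => [|n IH] s; [rewrite lee_fin|exact: iint_ge0].
by rewrite adde_ge0.
Qed.

Lemma L1c_fin f : L2 mu f -> L1c f \is a fin_num.
Proof.
move=> /L2P[mf]; rewrite N2E// => f2; rewrite ge0_fin_numE ?L1c_ge0//.
have g0 h : smf (h : _ -> mR) -> (0 <= iter m iint (fun s => (h s ^+ 2)%:E) [::])%E.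
  by move=> mh; exact: (snn_iter m (snn_sqr mh)).2.
apply: lte_add_pinfty; apply: L1_fin; try exact: smf_re; try exact: smf_im;
  apply: le_lt_trans f2.
  by rewrite leeDl// g0//; exact: smf_im.
by rewrite leeDr// g0//; exact: smf_re.
Qed.

Lemma L1c_sqr f : L2 mu f -> ((fine (L1c f) ^+ 2)%:E <= 2%:E * N2 mu f)%E.
Proof.
move=> f2; have := L1c_fin f2; have [mf _] := (L2P mu f).1 f2.
have snr := snn_norm (smf_re mf); have sni := snn_norm (smf_im mf).
have p0 := (snn_iter m snr).2 [::]; have q0 := (snn_iter m sni).2 [::].
rewrite N2E// fin_numD => /andP[fp fq].
have := @L1_sqr_le R (re f) m [::] _ (smf_re mf) _ _.
have := @L1_sqr_le R (im f) m [::] _ (smf_im mf) _ _.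
rewrite /L1c; move: p0 q0 fp fq.
case: (iter _ _ _ _) => // p; case: (iter _ _ _ _) => // q p0 q0 _ _.
move=> /(_ q q0 (lexx _)) hq /(_ p p0 (lexx _)) hp.
apply: le_trans (_ : 2%:E * ((p ^+ 2)%:E + (q ^+ 2)%:E) <= _)%E.
  rewrite -EFinD -EFinM lee_fin /= -subr_ge0.
  by rewrite (_ : _ - _ = (p - q) ^+ 2) ?sqr_ge0//; ring.
by apply: lee_wpmul2l => //; exact: leeD.
Qed.

Lemma wop_bound f j (x : m.-tuple R) : L2 mu f ->
  `|iter (j + m) wop (re f) x| <= fine (L1c f) * avoidP R S j /\
  `|iter (j + m) wop (im f) x| <= fine (L1c f) * avoidP R S j.
Proof.
move=> f2; have [mf _] := (L2P mu f).1 f2.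
have snr := snn_norm (smf_re mf); have sni := snn_norm (smf_im mf).
have p0 := (snn_iter m snr).2 [::]; have q0 := (snn_iter m sni).2 [::].
have dn h : dep m h -> dep m (fun s => `|h s|%:E) by move=> dh s u /dh ->.
split; rewrite -lee_fin EFinM fineK ?L1c_fin//.
  apply: le_trans (wop_norm _ _ _ (smf_re mf)) _.
  apply: le_trans (iter_ewop_bound _ _ snr (dn _ (@dep_re f)) (size_tuple x)) _.
  by apply: lee_wpmul2r; [rewrite lee_fin avoidP_ge0|rewrite leeDl].
apply: le_trans (wop_norm _ _ _ (smf_im mf)) _.
apply: le_trans (iter_ewop_bound _ _ sni (dn _ (@dep_im f)) (size_tuple x)) _.
by apply: lee_wpmul2r; [rewrite lee_fin avoidP_ge0|rewrite leeDr].
Qed.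

Lemma measurable_iint h : smf (h : _ -> mR) ->
  measurable_fun setT (fun x : m.-tuple mR => iint (fun s => `|h s|%:E) x).
Proof. by move=> mh; exact: (snn_iint (snn_norm mh)).1. Qed.

Lemma integral_iint h : smf (h : _ -> mR) -> dep m h ->
  (\int[mu]_x iint (fun s => `|h s|%:E) x = iter m iint (fun s => `|h s|%:E) [::])%E.
Proof.
move=> mh dh; rewrite -[RHS]iint_dep_stable; last by move=> s u /dh ->.
by rewrite integral_cube//; exact/snn_iint/snn_norm.
Qed.

(** The mean over [x] of the [L^1] norms of the sections is the [L^1] norm of [h], so almost every
    section is integrable. Linearity of [T] is available exactly at such points. *)
Lemma ae_iint_fin h : smf (h : _ -> mR) -> dep m h ->
  (iter m iint (fun s => `|h s|%:E) [::] < +oo)%E ->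
  {ae mu, forall x : m.-tuple mR, (iint (fun s => `|h s|%:E) x < +oo)%E}.
Proof.
move=> mh dh hoo.
have ge0 x := (snn_iint (snn_norm mh)).2 x.
have : mu.-integrable setT (fun x => iint (fun s => `|h s|%:E) x).
  apply/integrableP; split; first exact: measurable_iint.
  by under eq_integral do rewrite gee0_abs//; rewrite integral_iint.
move=> /(integrable_ae measurableT); apply: filterS => x /(_ Logic.I).
by rewrite ge0_fin_numE.
Qed.

Lemma ae_iint0 h : smf (h : _ -> mR) -> dep m h ->
  iter m iint (fun s => `|h s|%:E) [::] = 0%E ->
  {ae mu, forall x : m.-tuple mR, iint (fun s => `|h s|%:E) x = 0%E}.
Proof.
move=> mh dh h0.
have ge0 x := (snn_iint (snn_norm mh)).2 x.
have /(ae_eq_integral_abs mu measurableT (measurable_iint mh)) :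
    (\int[mu]_x `|iint (fun s => `|h s|%:E) x| = 0)%E.
  by under eq_integral do rewrite gee0_abs//; rewrite integral_iint.
by apply: filterS => x /(_ Logic.I).
Qed.

Lemma Top_L2 f : L2 mu f -> L2 mu (Top S f) /\ (N2 mu (Top S f) <= N2 mu f)%E.
Proof.
move=> /L2P[mf f2].
have mT := @cmeas_Top 1 f mf.
suff N : (N2 mu (Top S f) <= N2 mu f)%E.
  by split=> //; apply/L2P; split=> //; exact: le_lt_trans f2.
rewrite !N2E//; apply: leeD.
  apply: le_trans (wop_sqr_le S (smf_re mf) (@dep_re f)).
  rewrite le_eqVlt; apply/orP; left; apply/eqP; apply: eq_iter_iint => u _.
  by rewrite /re Top_wop.
apply: le_trans (wop_sqr_le S (smf_im mf) (@dep_im f)).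
rewrite le_eqVlt; apply/orP; left; apply/eqP; apply: eq_iter_iint => u _.
by rewrite /im Top_wop.
Qed.

Lemma ewop1_le (h : seq R -> \bar R) s : snn h -> (ewop h s <= iint h s)%E.
Proof. exact: (@iter_ewop_le R m S h 1 s). Qed.

(** A null set has null sections over almost every [x], so [T] respects almost-everywhere
    equality. *)
Lemma wop_ae_eq (h k : seq R -> R) : smf (h : _ -> mR) -> smf (k : _ -> mR) ->
  dep m h -> dep m k -> {ae mu, forall x : m.-tuple mR, h x = k x} ->
  {ae mu, forall x : m.-tuple mR, wop h x = wop k x}.
Proof.
move=> mh mk dh dk hk.
have mhk := smfB mh mk.
have dhk : dep m (fun s => h s - k s) by move=> s u su; rewrite (dh s u su) (dk s u su).
have : iter m iint (fun s => `|h s - k s|%:E) [::] = 0%E.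
  rewrite -integral_cube; last exact: snn_norm.
  rewrite -[RHS](@integral0 _ _ _ mu setT); apply: ge0_ae_eq_integral => //.
    exact: (snn_norm mhk).1.
  by apply: filterS hk => x -> _; rewrite subrr normr0.
move=> /(ae_iint0 mhk dhk); apply: filterS => x x0.
apply/eqP; rewrite -subr_eq0 -normr_le0 -lee_fin.
apply: le_trans (wop_dist S 1 x mh mk) _.
by apply: le_trans (ewop1_le _ (snn_norm mhk)) _; rewrite x0.
Qed.

Lemma Top_ae_eq (f g : m.-tuple mR -> R[i]) :
  L2 mu f -> L2 mu g -> f = g %[ae mu] -> Top S f = Top S g %[ae mu].
Proof.
move=> /L2P[mf _] /L2P[mg _] fg.
have h1 : {ae mu, forall x : m.-tuple mR, re f x = re g x}.
  by move: fg; apply: filterS => x /(_ Logic.I) xfg; rewrite /re !ext_tuple xfg.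
have h2 : {ae mu, forall x : m.-tuple mR, im f x = im g x}.
  by move: fg; apply: filterS => x /(_ Logic.I) xfg; rewrite /im !ext_tuple xfg.
have := wop_ae_eq (smf_re mf) (smf_re mg) (@dep_re f) (@dep_re g) h1.
have := wop_ae_eq (smf_im mf) (smf_im mg) (@dep_im f) (@dep_im g) h2.
apply: filterS2 => x hi hr _.
by rewrite -!(ext_tuple (Top S _)) !Top_wop -/(re f) -/(im f) -/(re g) -/(im g) hi hr.
Qed.

(** The real and imaginary parts of [c * f + g] are each combinations of three real functions. *)
Lemma wop_comb (a b : R) h1 h2 h3 s :
  smf (h1 : _ -> mR) -> smf (h2 : _ -> mR) -> smf (h3 : _ -> mR) ->
  (iint (fun s => `|h1 s|%:E) s < +oo)%E -> (iint (fun s => `|h2 s|%:E) s < +oo)%E ->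
  (iint (fun s => `|h3 s|%:E) s < +oo)%E ->
  wop (fun s => a * h1 s + (b * h2 s + h3 s)) s = a * wop h1 s + (b * wop h2 s + wop h3 s).
Proof.
move=> m1 m2 m3 f1 f2 f3.
have m23 : smf (fun s => b * h2 s + h3 s : mR).
  by apply: smfD => //; apply: smfM => // n; exact: measurable_cst.
rewrite wop_linear//; first by rewrite wop_linear.
have snb : snn (fun u : seq R => (`|b|%:E * `|h2 u|%:E)%E).
  by apply: snnM; [apply: snn_cst; rewrite lee_fin|exact: snn_norm].
apply: le_lt_trans (_ : iint (fun u => `|b|%:E * `|h2 u|%:E + `|h3 u|%:E)%E s < _)%E.
  apply: le_iint => [||t]; first exact: snn_norm.
    by apply: snnD => //; exact: snn_norm.
  by rewrite -EFinM -EFinD lee_fin -normrM ler_normD.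
have /= -> := iter_iintD 1 s snb (snn_norm m3); apply: lte_add_pinfty => //.
have b0 : (0 <= `|b|%:E)%E by rewrite lee_fin.
have /= -> := iter_iintZ 1 s (snn_norm m2) b0.
by rewrite lte_mul_pinfty// lee_fin.
Qed.

Lemma Top_linear c f g : L2 mu f -> L2 mu g ->
  Top S (fun x => c * f x + g x) = (fun x => c * Top S f x + Top S g x) %[ae mu].
Proof.
move=> f2 g2; have [mf _] := (L2P mu f).1 f2; have [mg _] := (L2P mu g).1 g2.
have fin k : L2 mu k -> {ae mu, forall x : m.-tuple mR,
    (iint (fun s => `|re k s|%:E) x < +oo)%E /\ (iint (fun s => `|im k s|%:E) x < +oo)%E}.
  move=> k2; have [mk _] := (L2P mu k).1 k2.
  have := L1c_fin k2; rewrite fin_numD => /andP[].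
  rewrite !ge0_fin_numE; last 2 first.
  - exact: (snn_iter m (snn_norm (smf_im mk))).2.
  - exact: (snn_iter m (snn_norm (smf_re mk))).2.
  move=> /(ae_iint_fin (smf_re mk) (@dep_re k)) h1 /(ae_iint_fin (smf_im mk) (@dep_im k)) h2.
  by apply: filterS2 h1 h2 => x.
have := fin f f2; have := fin g g2; apply: filterS2 => x [gr gi] [fr fi] _.
rewrite -!(ext_tuple (Top S _)) !Top_wop.
rewrite -[c in RHS]/(c) -/(re f) -/(im f) -/(re g) -/(im g).
have -> : (fun u => complex.Re (ext (fun x => c * f x + g x) u)) =
   (fun u => complex.Re c * re f u + (- complex.Im c * im f u + re g u)).
  by apply/funext => u; rewrite /ext Re_lin.
have -> : (fun u => complex.Im (ext (fun x => c * f x + g x) u)) =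
   (fun u => complex.Re c * im f u + (complex.Im c * re f u + im g u)).
  by apply/funext => u; rewrite /ext Im_lin.
rewrite !wop_comb//; try exact: smf_re; try exact: smf_im.
by rewrite [RHS]complexE -[RHS]complexE; apply/eqP; rewrite eq_complex Re_lin Im_lin !eqxx.
Qed.

Lemma bounded_Top : bounded_operator mu (Top S).
Proof.
apply/bounded_operatorP; split.
- by move=> f /Top_L2[].
- exact: Top_ae_eq.
- exact: Top_linear.
by exists 1 => // f f2; rewrite mul1e; exact: (Top_L2 f2).2.
Qed.

End Top_bounded.

(** * Series with a geometric majorant *)

Section geometric_majoration.
Context (R : realType).

Lemma cvg_geo_majorated (u : nat -> R) (B q : R) (m : nat) : 0 < q -> q < 1 ->
  (forall k, (m <= k)%N -> `|u k| <= B * q ^+ k) ->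
  cvgn (series u) /\
  forall n, (m <= n)%N -> `|limn (series u) - series u n| <= B / (1 - q) * q ^+ n.
Proof.
move=> q0 q1 uB.
have B0 : 0 <= B.
  by have := le_trans (normr_ge0 _) (uB m (leqnn m)); rewrite pmulr_lge0 ?exprn_gt0.
have q'0 : 0 < 1 - q by rewrite subr_gt0.
have cu : cvgn (series u).
  apply: normed_cvg; rewrite /=.
  (* The added sum extends the majoration to the finitely many indices below [m]. *)
  pose B' := B + \sum_(k < m) `|u k| / q ^+ k.
  have s0 : 0 <= \sum_(k < m) `|u k| / q ^+ k.
    by apply: sumr_ge0 => k _; rewrite divr_ge0// exprn_ge0// ltW.
  have B'0 : 0 <= B' by rewrite addr_ge0.
  apply: (@series_le_cvg _ _ (geometric B' q)) => //.
  - by move=> n /=.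
  - by move=> n; rewrite /geometric /= mulr_ge0// exprn_ge0// ltW.
  - move=> n; rewrite /geometric /=; have [mn|nm] := leqP m n.
      apply: le_trans (uB _ mn) _; rewrite ler_wpM2r ?exprn_ge0 ?(ltW q0)//.
      by rewrite lerDl.
    rewrite -ler_pdivrMr ?exprn_gt0// /B' (bigD1 (Ordinal nm))//= addrCA lerDl.
    by rewrite addr_ge0// sumr_ge0// => k _; rewrite divr_ge0// exprn_ge0// ltW.
  - by apply: is_cvg_geometric_series; rewrite ger0_norm// ltW.
split=> // n mn.
(* Subtracting [q ^ (n + j)] gives the exact geometric partial sum, which makes the induction on [j]
   close. *)
have step j : `|series u (n + j)%N - series u n| <= B / (1 - q) * (q ^+ n - q ^+ (n + j)).
  elim: j => [|j IH]; first by rewrite addn0 !subrr normr0 mulr0.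
  rewrite addnS seriesSr (addrC (series u _)) -addrA.
  apply: le_trans (ler_normD _ _) _.
  apply: le_trans (lerD (uB _ _) IH) _; first by rewrite (leq_trans mn)// leq_addr.
  rewrite exprS le_eqVlt; apply/orP; left; apply/eqP; field.
  by rewrite gt_eqF.
have c1 : `|series u k - series u n| @[k --> \oo] --> `|limn (series u) - series u n|.
  apply: cvg_norm; apply: cvgB => //; exact: cvg_cst.
apply: cvgr_to_le c1 _.
exists n => // k /= nk.
rewrite -(subnKC nk); apply: le_trans (step _) _.
rewrite ler_wpM2l//; first by rewrite divr_ge0// ltW.
by rewrite gerBl exprn_ge0// ltW.
Qed.

Lemma geo_majorated_eq0 (z B q : R) (m : nat) : 0 < q -> q < 1 -> 0 <= z ->
  (forall n, (m <= n)%N -> z <= B * q ^+ n) -> z = 0.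
Proof.
move=> q0 q1 z0 zB; apply/eqP; rewrite eq_le z0 andbT.
have c : geometric B q k @[k --> \oo] --> 0.
  by apply: cvg_geometric; rewrite ger0_norm// ltW.
apply: cvgr_to_ge c _.
by exists m => // k /= mk; exact: zB.
Qed.

End geometric_majoration.

(** * Inequalities for the complex modulus *)

Section complex_modulus.
Context (R : realType).
Local Notation normc := (@ComplexField.Normc.normc R).
Implicit Types z w : R[i].

Lemma normc_ge0 z : 0 <= normc z.
Proof. by rewrite normc_sqn sqrtr_ge0. Qed.

Lemma normc_le z : normc z <= `|complex.Re z| + `|complex.Im z|.
Proof.
rewrite -(@ler_pXn2r _ 2)// ?nnegrE ?normc_ge0 ?addr_ge0//.
rewrite normc_sqr /sqn sqrrD !real_normK ?num_real// -addrA lerD2l lerDr.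
by rewrite mulrn_wge0// mulr_ge0.
Qed.

Lemma Re_le_normc z : `|complex.Re z| <= normc z.
Proof.
rewrite -(@ler_pXn2r _ 2)// ?nnegrE ?normc_ge0//.
by rewrite normc_sqr /sqn real_normK ?num_real// lerDl sqr_ge0.
Qed.

Lemma Im_le_normc z : `|complex.Im z| <= normc z.
Proof.
rewrite -(@ler_pXn2r _ 2)// ?nnegrE ?normc_ge0//.
by rewrite normc_sqr /sqn real_normK ?num_real// lerDr sqr_ge0.
Qed.

Lemma normcD_le z w : normc (z + w) <= normc z + normc w.
Proof. exact: (@le_normcD R z w). Qed.

Lemma normcB_le z w : normc (z - w) <= normc z + normc w.
Proof.
apply: le_trans (normcD_le _ _) _.
by rewrite lerD2l (_ : normc (- w) = normc w)//; exact: (@normcN R w).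
Qed.

Lemma normcX z n : normc (z ^+ n) = normc z ^+ n.
Proof.
elim: n => [|n IH]; first by rewrite !expr0 ComplexField.Normc.normc1.
by rewrite !exprS ComplexField.Normc.normcM IH.
Qed.

Lemma Re_sum n (F : nat -> R[i]) :
  complex.Re (\sum_(k < n) F k) = \sum_(k < n) complex.Re (F k).
Proof.
elim: n => [|n IH]; first by rewrite !big_ord0.
by rewrite !big_ord_recr /= -IH; case: (\sum_(_ < _) _) => a b; case: (F n).
Qed.

Lemma Im_sum n (F : nat -> R[i]) :
  complex.Im (\sum_(k < n) F k) = \sum_(k < n) complex.Im (F k).
Proof.
elim: n => [|n IH]; first by rewrite !big_ord0.
by rewrite !big_ord_recr /= -IH; case: (\sum_(_ < _) _) => a b; case: (F n).
Qed.

End complex_modulus.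

(** * Differences under almost-everywhere linear operators *)

Section bounded_operator_rules.
Context d (X : measurableType d) (R : realType) (mu : {measure set X -> \bar R}).

Lemma bounded_operatorB (A : (X -> R[i]) -> (X -> R[i])) c f g :
  bounded_operator mu A -> L2 mu f -> L2 mu g ->
  A (fun x => c * f x - g x) = (fun x => c * A f x - A g x) %[ae mu].
Proof.
move=> [a1 a2 a3 _] f2 g2.
have z2 := L2_0 mu.
have A0 : {ae mu, forall x, A (fun _ => 0) x = 0}.
  (* Linearity with scalar -1 at the zero function gives [A 0 = - A 0 + A 0], so [A 0] vanishes
     almost everywhere. *)
  have := a3 (-1) _ _ z2 z2.
  rewrite (_ : (fun x : X => -1 * 0 + 0) = (fun _ => 0 : R[i])); last first.
    by apply/funext => x; rewrite mulr0 addr0.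
  by apply: filterS => x /(_ Logic.I) ->; rewrite mulN1r addNr.
have N2 := L2_lin (-1) g2 z2.
have h1 := a3 (-1) _ _ g2 z2.
have h2 := a3 c _ _ f2 N2.
rewrite (_ : (fun x => c * f x - g x) = (fun x => c * f x + (-1 * g x + 0))); last first.
  by apply/funext => x; rewrite addr0 mulN1r.
near=> x => _.
have -> : A (fun x => c * f x + (-1 * g x + 0)) x =
    c * A f x + A (fun x => -1 * g x + 0) x by near: x; apply: filterS h2 => x; exact.
have -> : A (fun x => -1 * g x + 0) x = -1 * A g x + A (fun _ => 0) x.
  by near: x; apply: filterS h1 => x; exact.
have -> : A (fun _ => 0) x = 0 by near: x; exact: A0.
by rewrite mulN1r addr0.
Unshelve. all: by end_near. Qed.

Lemma L2B c f g : L2 mu f -> L2 mu g -> L2 mu (fun x => c * f x - g x).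
Proof.
move=> f2 g2.
rewrite (_ : (fun x => c * f x - g x) = (fun x => c * f x + (-1 * g x + 0))); last first.
  by apply/funext => x; rewrite addr0 mulN1r.
by apply: L2_lin => //; apply: L2_lin => //; exact: L2_0.
Qed.

End bounded_operator_rules.

(** * The resolvent outside the disk of radius the growth rate *)

Section neumann.
Context (R : realType) (m : nat) (S : {set 'S_m.+1}).
Local Notation mR := (measurableTypeR R).
Local Notation mu := (cube R m).
Local Notation T := (@Top R m S).
Local Notation normc := (@ComplexField.Normc.normc R).
Local Notation a := (avoidP R S).
Local Notation L := (growth a).
Implicit Types (f g : m.-tuple mR -> R[i]).

Definition nterm (l : R[i]) k f (x : m.-tuple mR) : R[i] := l^-1 ^+ k.+1 * iter k T f x.

Definition psum (l : R[i]) n f (x : m.-tuple mR) : R[i] := \sum_(k < n) nterm l k f x.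

Lemma psumS l n : psum l n.+1 = fun f x => l^-1 ^+ n.+1 * iter n T f x + psum l n f x.
Proof. by apply/funext => f; apply/funext => x; rewrite /psum big_ord_recr/= addrC. Qed.

Lemma bounded_psum l n : bounded_operator mu (psum l n).
Proof.
elim: n => [|n IH].
  rewrite (_ : psum l 0 = fun _ _ => 0); first exact: bounded_operator0.
  by apply/funext => f; apply/funext => x; rewrite /psum big_ord0.
rewrite psumS; apply: bounded_operator_lin IH.
exact: bounded_operator_iter (bounded_Top R S).
Qed.

Lemma psum_Top l n f x : l != 0 -> psum l n (T f) x = l * psum l n.+1 f x - f x.
Proof.
move=> l0.
have -> : psum l n.+1 f x = l^-1 * f x + \sum_(k < n) nterm l k.+1 f x.
  by rewrite /psum big_ord_recl /nterm expr1.
rewrite mulrDr mulVKf// addrC addKr.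
rewrite big_distrr /=; apply: eq_bigr => k _; rewrite /nterm -iterSr mulrA; congr (_ * _).
by rewrite [in RHS]exprS mulrA mulfV// mul1r.
Qed.

(** Unlike [psum_Top], where [T] is applied first and the sum telescopes everywhere, here [T] passes
    through a sum, which holds only off a null set. *)
Lemma Top_psum l n f : l != 0 -> L2 mu f ->
  {ae mu, forall x : m.-tuple mR, T (psum l n f) x = l * psum l n.+1 f x - f x}.
Proof.
move=> l0 f2; have [t1 _ t3 _] := bounded_Top R S.
have it k : L2 mu (iter k T f).
  by have [+ _ _ _] := bounded_operator_iter k (bounded_Top R S); apply.
have ps k : L2 mu (psum l k f) by have [+ _ _ _] := bounded_psum l k; apply.
elim: n => [|n IH].
  have z2 := L2_0 mu.
  have := t3 (-1) _ _ z2 z2.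
  rewrite (_ : (fun x => -1 * 0 + 0) = (fun _ => 0 : R[i])); last first.
    by apply/funext => x; rewrite mulr0 addr0.
  apply: filterS => x /(_ Logic.I).
  rewrite (_ : psum l 0 f = (fun _ => 0)); last first.
    by apply/funext => y; rewrite /psum big_ord0.
  by move=> ->; rewrite mulN1r addNr /psum big_ord1 /nterm expr1 /= mulVKf// subrr.
have := t3 (l^-1 ^+ n.+1) _ _ (it n) (ps n).
apply: filterS2 IH => x IH /(_ Logic.I); rewrite {1}psumS => ->; rewrite IH.
rewrite [in RHS]psumS mulrDr -addrA; congr (_ + _).
by rewrite mulrA [in RHS]exprS mulrA mulfV// mul1r.
Qed.

(** Uniform continuity at every point, used to exchange [T] with the uniform limit of Neumann sums;
    the factor 2 adds the real and imaginary parts. *)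
Lemma Top_dist f g e (x : m.-tuple mR) : cmeas f -> cmeas g -> 0 <= e ->
  (forall y, normc (f y - g y) <= e) -> normc (T f x - T g x) <= 2 * e.
Proof.
move=> mf mg e0 fg.
have b h k : smf (h : _ -> mR) -> smf (k : _ -> mR) -> (forall s, `|h s - k s| <= e) ->
    `|wop S h x - wop S k x| <= e.
  move=> mh mk hk; rewrite -lee_fin; apply: le_trans (wop_dist S 1 x mh mk) _.
  have sn := snn_norm (smfB mh mk).
  apply: le_trans (ewop1_le S x sn) _.
  rewrite -(iter_iint_cst 1 x (_ : (0 <= e%:E)%E)) ?lee_fin//=.
  by apply: le_iint; [exact: sn|exact: snn_cst|move=> t; rewrite lee_fin].
apply: le_trans (normc_le _) _; rewrite mulrDl mul1r.
rewrite -!(ext_tuple (T _)) !Top_wop.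
apply: lerD; apply: b.
- exact: smf_re mf.
- exact: smf_re mg.
- move=> s; apply: le_trans (fg [tuple s`_i | i < m]); apply: le_trans (Re_le_normc _).
  by rewrite /ext; case: (f _) => ? ?; case: (g _).
- exact: smf_im mf.
- exact: smf_im mg.
- move=> s; apply: le_trans (fg [tuple s`_i | i < m]); apply: le_trans (Im_le_normc _).
  by rewrite /ext; case: (f _) => ? ?; case: (g _).
Qed.

Lemma growth_avoid_ge0 : 0 <= L.
Proof. by apply: growth_ge0 => n; exact: avoidP_le1. Qed.

Lemma lt_growth_avoid r : L < r -> exists2 C, 0 < C & forall n, a n <= C * r ^+ n.
Proof.
apply: lt_growth; first exact: avoidP_ge0.
- exact: avoidP_le1.
- by rewrite avoidP_short.
- exact: avoidP_submul.
Qed.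

Section resolvent.
Context (l : R[i]) (Ll : L < normc l).

Let l0 : l != 0.
Proof.
apply: contraTneq Ll => ->.
by rewrite ComplexField.Normc.normc0 -leNgt growth_avoid_ge0.
Qed.

Let nl0 : 0 < normc l.
Proof. exact: le_lt_trans growth_avoid_ge0 Ll. Qed.

Lemma nterm_bound : exists q D, [/\ 0 < q, q < 1, 0 <= D &
  forall f x k, L2 mu f -> (m <= k)%N -> normc (nterm l k f x) <= fine (L1c f) * D * q ^+ k].
Proof.
have [r [Lr rl]] : exists r, L < r /\ r < normc l.
  by exists ((L + normc l) / 2); split; rewrite midf_lt.
have r0 : 0 < r by apply: le_lt_trans Lr; exact: growth_avoid_ge0.
have [C C0 aC] := lt_growth_avoid Lr.
(* [2] adds the two real parts, [r ^ m] compensates the shift [j = k - m] in [wop_bound], and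
   [normc l] the extra power in [l^-(k+1)]. *)
exists (r / normc l), (2 * C / (normc l * r ^+ m)); split.
- by rewrite divr_gt0.
- by rewrite ltr_pdivrMr// mul1r.
- by rewrite divr_ge0// mulr_ge0 ?ltW// exprn_gt0.
move=> f x k f2 /subnK <-; set j := (k - m)%N.
have c0 : 0 <= fine (L1c f) by rewrite fine_ge0// L1c_ge0.
have [b1 b2] := wop_bound S j x f2.
rewrite /nterm ComplexField.Normc.normcM normcX ComplexField.Normc.normcV iter_Top.
apply: le_trans (ler_wpM2l _ (_ : _ <= 2 * fine (L1c f) * (C * r ^+ j))) _.
- by rewrite exprn_ge0// invr_ge0 ltW.
- apply: le_trans (normc_le _) _.
  apply: le_trans (lerD b1 b2) _; rewrite -mulr2n -[leLHS]mulr_natl -mulrA.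
  by rewrite ler_wpM2l// ler_wpM2l.
rewrite le_eqVlt; apply/orP; left; apply/eqP.
rewrite exprVn exprS !exprMn !exprVn !exprD; field.
by rewrite ?expf_neq0 ?gt_eqF.
Qed.

(** A pointwise limit yields a genuine function rather than a class; for [f] in [L^2] the
    convergence is uniform in [x]. *)
Definition neumann f (x : m.-tuple mR) : R[i] :=
  Complex (limn (fun n => complex.Re (psum l n f x)))
          (limn (fun n => complex.Im (psum l n f x))).

Lemma psum_series f x :
  (fun n => complex.Re (psum l n f x)) =
    series (fun k => complex.Re (nterm l k f x)) /\
  (fun n => complex.Im (psum l n f x)) =
    series (fun k => complex.Im (nterm l k f x)).
Proof.
split; apply/funext => n; rewrite /series /= big_mkord /psum.
  exact: (Re_sum n (fun k => nterm l k f x)).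
exact: (Im_sum n (fun k => nterm l k f x)).
Qed.

Lemma neumann_dist : exists q E, [/\ 0 < q, q < 1, 0 <= E &
  forall f x n, L2 mu f -> (m <= n)%N ->
    normc (neumann f x - psum l n f x) <= fine (L1c f) * E * q ^+ n].
Proof.
have [q [D [q0 q1 D0 tD]]] := nterm_bound.
have q'0 : 0 < 1 - q by rewrite subr_gt0.
exists q, (2 * (D / (1 - q))); split=> //; first by rewrite mulr_ge0// divr_ge0// ltW.
move=> f x n f2 mn; have [sr si] := psum_series f x.
have hr k : (m <= k)%N -> `|complex.Re (nterm l k f x)| <= fine (L1c f) * D * q ^+ k.
  by move=> mk; apply: le_trans (Re_le_normc _) (tD f x k f2 mk).
have hi k : (m <= k)%N -> `|complex.Im (nterm l k f x)| <= fine (L1c f) * D * q ^+ k.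
  by move=> mk; apply: le_trans (Im_le_normc _) (tD f x k f2 mk).
have [_ /(_ n mn) br] := cvg_geo_majorated q0 q1 hr.
have [_ /(_ n mn) bi] := cvg_geo_majorated q0 q1 hi.
rewrite -sr in br; rewrite -si in bi.
apply: le_trans (normc_le _) _.
have -> : complex.Re (neumann f x - psum l n f x) =
    limn (fun n => complex.Re (psum l n f x)) - complex.Re (psum l n f x).
  by rewrite /neumann; case: (psum l n f x).
have -> : complex.Im (neumann f x - psum l n f x) =
    limn (fun n => complex.Im (psum l n f x)) - complex.Im (psum l n f x).
  by rewrite /neumann; case: (psum l n f x).
apply: le_trans (lerD br bi) _.
by rewrite le_eqVlt; apply/orP; left; apply/eqP; ring.
Qed.

Lemma cvg_neumann f x : L2 mu f ->
  (complex.Re (psum l n f x) @[n --> \oo] --> complex.Re (neumann f x)) /\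
  (complex.Im (psum l n f x) @[n --> \oo] --> complex.Im (neumann f x)).
Proof.
move=> f2; have [q [D [q0 q1 D0 tD]]] := nterm_bound.
have [sr si] := psum_series f x.
have hr k : (m <= k)%N -> `|complex.Re (nterm l k f x)| <= fine (L1c f) * D * q ^+ k.
  by move=> mk; apply: le_trans (Re_le_normc _) (tD f x k f2 mk).
have hi k : (m <= k)%N -> `|complex.Im (nterm l k f x)| <= fine (L1c f) * D * q ^+ k.
  by move=> mk; apply: le_trans (Im_le_normc _) (tD f x k f2 mk).
have [cr _] := cvg_geo_majorated q0 q1 hr.
have [ci _] := cvg_geo_majorated q0 q1 hi.
by rewrite /neumann /= sr si.
Qed.

Lemma cmeas_neumann f : L2 mu f -> cmeas (neumann f).
Proof.
move=> f2.
have ps n : cmeas (psum l n f).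
  by have [+ _ _ _] := bounded_psum l n; move=> /(_ f f2)/L2P[].
split.
  apply: (@measurable_fun_cvg _ _ _ _ (fun n x => complex.Re (psum l n f x))).
    by move=> n; exact: (ps n).1.
  by move=> x _; exact: (cvg_neumann x f2).1.
apply: (@measurable_fun_cvg _ _ _ _ (fun n x => complex.Im (psum l n f x))).
  by move=> n; exact: (ps n).2.
by move=> x _; exact: (cvg_neumann x f2).2.
Qed.

(** The first [m] terms form a bounded operator, and the rest is bounded uniformly by a multiple of
    [L1c f]. In [4 * K] one factor 2 comes from [N2_lin], the other from [L1c_sqr]. *)
Lemma neumann_L2 : exists2 M : R, 0 <= M & forall f, L2 mu f ->
  L2 mu (neumann f) /\ (N2 mu (neumann f) <= M%:E * N2 mu f)%E.
Proof.
have [q [E [q0 q1 E0 nE]]] := neumann_dist.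
have /bounded_operatorP[p1 _ _ [M M0 pM]] := bounded_psum l m.
have [K K0 KE] : exists2 K : R, 0 <= K & K = (E * q ^+ m) ^+ 2.
  by exists ((E * q ^+ m) ^+ 2); rewrite ?sqr_ge0.
exists (2 * M + 4 * K); first by apply: addr_ge0; apply: mulr_ge0.
move=> f f2; have mA := cmeas_neumann f2.
have [mp _] := (L2P mu _).1 (p1 f f2).
suff N : (N2 mu (neumann f) <= (2 * M + 4 * K)%:E * N2 mu f)%E.
  split=> //; apply/L2P; split=> //; apply: le_lt_trans N _.
  have [_ ff] := (L2P mu f).1 f2.
  by apply: lte_mul_pinfty => //; rewrite lee_fin addr_ge0// mulr_ge0.
pose t x := neumann f x - psum l m f x.
have mt : cmeas t.
  rewrite (_ : t = fun x => (-1) * psum l m f x + neumann f x).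
    exact: cmeas_lin.
  by apply/funext => x; rewrite mulN1r addrC.
have -> : neumann f = (fun x => 1 * psum l m f x + t x).
  by apply/funext => x; rewrite /t mul1r addrC subrK.
apply: le_trans (N2_lin mu 1 mp mt) _.
have -> : sqn (1 : R[i]) = 1 by rewrite /sqn /= expr1n expr0n addr0.
rewrite mulr1 [(_ + 4 * K)%:E]EFinD [leRHS]ge0_muleDl ?lee_fin ?mulr_ge0//.
apply: leeD.
  by rewrite [(_ * M)%:E]EFinM -muleA; apply: lee_wpmul2l; [rewrite lee_fin|exact: pM].
have tb : (N2 mu t <= ((fine (L1c f)) ^+ 2 * K)%:E)%E.
  rewrite -[leRHS]mule1 -(@probability_setT _ _ _ mu) -integral_cst//.
  apply: ge0_le_integral => //.
  - by move=> x _; rewrite lee_fin sqn_ge0.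
  - exact: measurable_sqn.
  move=> x _; rewrite lee_fin -normc_sqr KE -exprMn mulrA.
  rewrite lerXn2r ?nnegrE ?normc_ge0//; last exact: nE.
  by rewrite mulr_ge0 ?exprn_ge0 ?(ltW q0)// mulr_ge0// fine_ge0// L1c_ge0.
apply: le_trans (lee_wpmul2l _ tb) _; first by rewrite lee_fin.
rewrite -EFinM (_ : 2 * _ = (2 * K) * fine (L1c f) ^+ 2); last by ring.
rewrite (_ : 4 * K = (2 * K) * 2); last by ring.
rewrite (EFinM (2 * K) (_ ^+ 2)) (EFinM (2 * K) 2) -muleA.
by apply: lee_wpmul2l; [rewrite lee_fin mulr_ge0|exact: L1c_sqr].
Qed.

Lemma neumann_eq z B q : 0 < q -> q < 1 ->
  (forall n, (m <= n)%N -> normc z <= B * q ^+ n) -> z = 0.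
Proof.
move=> q0 q1 zB; apply: ComplexField.Normc.eq0_normc.
exact: (geo_majorated_eq0 q0 q1 (normc_ge0 z) zB).
Qed.

Lemma bounded_neumann : bounded_operator mu neumann.
Proof.
have [M M0 nM] := neumann_L2.
apply/bounded_operatorP; split; last by exists M => // f /nM[].
- by move=> f /nM[].
- move=> f g f2 g2 fg.
  (* Countably many partial sums give one common null set, off which the limits agree. *)
  have : {ae mu, forall x : m.-tuple mR, forall n, psum l n f x = psum l n g x}.
    apply: ae_foralln => n; have [_ p2 _ _] := bounded_psum l n.
    by have := p2 f g f2 g2 fg; apply: filterS => x /(_ Logic.I).
  apply: filterS => x fgx _; rewrite /neumann.
  by congr (Complex (limn _) (limn _)); apply/funext => n; rewrite fgx.
move=> c f g f2 g2.
have fg2 := L2_lin c f2 g2.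
have [q [E [q0 q1 E0 nE]]] := neumann_dist.
have : {ae mu, forall x : m.-tuple mR, forall n, psum l n (fun x => c * f x + g x) x =
    c * psum l n f x + psum l n g x}.
  apply: ae_foralln => n; have [_ _ p3 _] := bounded_psum l n.
  by have := p3 c f g f2 g2; apply: filterS => x /(_ Logic.I).
apply: filterS => x fgx _; apply/eqP; rewrite -subr_eq0; apply/eqP.
apply: (@neumann_eq _ (fine (L1c (fun x => c * f x + g x)%R) * E +
  (normc c * (fine (L1c f) * E) + fine (L1c g) * E)) q) => // n mn.
rewrite (_ : _ - _ = (neumann (fun x => c * f x + g x) x - psum l n (fun x => c * f x + g x) x)
  - (c * (neumann f x - psum l n f x) + (neumann g x - psum l n g x))); last first.
  by rewrite fgx; ring.
apply: le_trans (normcB_le _ _) _; rewrite [leRHS]mulrDl; apply: lerD; first exact: nE.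
apply: le_trans (normcD_le _ _) _; rewrite [leRHS]mulrDl; apply: lerD; last exact: nE.
rewrite ComplexField.Normc.normcM -[leRHS]mulrA ler_wpM2l ?normc_ge0//; exact: nE.
Qed.

Lemma neumann_left f : L2 mu f -> neumann (fun x => l * f x - T f x) = f %[ae mu].
Proof.
move=> f2; have T2 : L2 mu (T f) by have [+ _ _ _] := bounded_Top R S; apply.
have g2 := L2B l f2 T2.
have [q [E [q0 q1 E0 nE]]] := neumann_dist.
have : {ae mu, forall x : m.-tuple mR, forall n, psum l n (fun x => l * f x - T f x) x =
    l * psum l n f x - psum l n (T f) x}.
  apply: ae_foralln => n.
  by have := bounded_operatorB l (bounded_psum l n) f2 T2; apply: filterS => x /(_ Logic.I).
apply: filterS => x fgx _; apply/eqP; rewrite -subr_eq0; apply/eqP.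
have c0 : 0 <= fine (L1c f) by rewrite fine_ge0// L1c_ge0.
apply: (@neumann_eq _ (fine (L1c (fun x => l * f x - T f x)%R) * E +
  normc l * (fine (L1c f) * E + fine (L1c f) * E)) q) => // n mn.
(* By [psum_Top] the partial sums satisfy the identity up to [l * (psum l n f - psum l n.+1 f)];
   each bracket is a distance to a Neumann limit and decays like [q ^ n]. *)
rewrite (_ : _ - _ =
  (neumann (fun x => l * f x - T f x) x - psum l n (fun x => l * f x - T f x) x)
  - l * ((neumann f x - psum l n f x) - (neumann f x - psum l n.+1 f x))); last first.
  by rewrite fgx psum_Top//; ring.
apply: le_trans (normcB_le _ _) _; rewrite [leRHS]mulrDl; apply: lerD; first exact: nE.
rewrite ComplexField.Normc.normcM -[leRHS]mulrA ler_wpM2l ?normc_ge0//.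
apply: le_trans (normcB_le _ _) _; rewrite [leRHS]mulrDl; apply: lerD; first exact: nE.
apply: le_trans (nE _ _ _ f2 (leqW mn)) _.
by rewrite exprS ler_wpM2l ?mulr_ge0// ler_piMl ?exprn_ge0 ?ltW.
Qed.

Lemma neumann_right f : L2 mu f ->
  (fun x : m.-tuple mR => l * neumann f x - T (neumann f) x) = f %[ae mu].
Proof.
move=> f2.
have [q [E [q0 q1 E0 nE]]] := neumann_dist.
have c0 : 0 <= fine (L1c f) by rewrite fine_ge0// L1c_ge0.
have : {ae mu, forall x : m.-tuple mR, forall n, T (psum l n f) x = l * psum l n.+1 f x - f x}.
  by apply: ae_foralln => n; exact: Top_psum.
apply: filterS => x fx _; apply/eqP; rewrite -subr_eq0; apply/eqP.
apply: (@neumann_eq _ (normc l * (fine (L1c f) * E) + 2 * (fine (L1c f) * E)) q) => // n mn.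
(* The partial sums satisfy [l * psum l n.+1 f - T (psum l n f) = f] at [x]; both errors are
   geometric, the second by [Top_dist]. *)
rewrite (_ : _ - _ = l * (neumann f x - psum l n.+1 f x) -
  (T (neumann f) x - T (psum l n f) x)); last by rewrite fx; ring.
apply: le_trans (normcB_le _ _) _; rewrite [leRHS]mulrDl; apply: lerD.
  rewrite ComplexField.Normc.normcM -[leRHS]mulrA ler_wpM2l ?normc_ge0//.
  apply: le_trans (nE _ _ _ f2 (leqW mn)) _.
  by rewrite exprS ler_wpM2l ?mulr_ge0// ler_piMl ?exprn_ge0 ?ltW.
rewrite -[leRHS]mulrA; apply: Top_dist.
- exact: cmeas_neumann.
- by have [+ _ _ _] := bounded_psum l n; move=> /(_ f f2)/L2P[].
- by apply: mulr_ge0; [exact: mulr_ge0|rewrite exprn_ge0 ?ltW].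
- by move=> y; exact: nE.
Qed.

Lemma resolvent_gt_growth : resolvent_set mu T l.
Proof.
exists neumann; split; first exact: bounded_neumann.
by move=> f f2; split; [exact: neumann_left|exact: neumann_right].
Qed.

End resolvent.

End neumann.

(** * The growth rate is a spectral value *)

Section growth_in_spectrum.
Context (R : realType) (m : nat) (S : {set 'S_m.+1}).
Local Notation mR := (measurableTypeR R).
Local Notation mu := (cube R m).
Local Notation T := (@Top R m S).
Local Notation a := (avoidP R S).
Local Notation L := (growth a).
Local Notation wop := (@wop R m S).
Local Notation ewop := (@ewop R m S).
Local Notation one := (fun _ : m.-tuple mR => 1 : R[i]).

Lemma rint_ge0E (h : seq R -> R) s : smf (h : _ -> mR) -> (forall u, 0 <= h u) ->
  (iint (fun u => (h u)%:E) s < +oo)%E -> (rint h s)%:E = iint (fun u => (h u)%:E) s.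
Proof.
move=> mh h0 hoo.
have sn : snn (fun u => (h u)%:E).
  by split=> [n|u]; [apply/measurable_EFinP; exact: mh|rewrite lee_fin].
move: hoo; rewrite (iintE s sn) => hoo.
rewrite /rint /Rintegral fineK// ge0_fin_numE//.
by apply: integral_ge0 => t _; rewrite lee_fin.
Qed.

Lemma wop1_ewop k s : (iter k wop (cst 1) s)%:E = iter k ewop (cst 1%E) s.
Proof.
elim: k s => // k IH s; rewrite !iterS.
have sn1 : snn (cst 1%E : seq R -> \bar R) by exact: snn_cst.
have h0 u : 0 <= iter k wop (cst 1) u by rewrite -lee_fin IH; exact: (snn_ewop S k sn1).2.
have E : (fun u => (wnd S u * iter k wop (cst 1) u)%:E) =
    (fun u => (wnd S u)%:E * iter k ewop (cst 1) u)%E.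
  by apply/funext => u; rewrite EFinM IH.
rewrite /wop rint_ge0E ?E//.
- apply: smfM; first exact: smf_wnd.
  by apply: smf_wop => n; exact: measurable_cst.
- by move=> u; rewrite mulr_ge0// wnd_ge0.
apply: le_lt_trans (iter_ewop_le S k.+1 s sn1) _.
by rewrite iter_iint_cst// ltry.
Qed.

Lemma wop1_ge0 k s : 0 <= iter k wop (cst 1) s.
Proof. by rewrite -lee_fin wop1_ewop; apply: (snn_ewop S k _).2; exact: snn_cst. Qed.

Lemma wop1_le k (x : m.-tuple R) : iter k wop (cst 1) x <= a k.
Proof. by rewrite -lee_fin wop1_ewop iter_ewop1_le// size_tuple. Qed.

Lemma iter_Top1 k x : iter k T one x = (iter k wop (cst 1) x)%:C%C.
Proof. by rewrite iter_Top (_ : (fun _ => complex.Im _) = cst 0)// wop0. Qed.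

Definition rsum (l : R) n s : R := \sum_(k < n) l^-1 ^+ k.+1 * iter k wop (cst 1) s.

Lemma psum1 (l : R) n x : psum S l%:C%C n one x = (rsum l n x)%:C%C.
Proof.
rewrite /psum /rsum rmorph_sum; apply: eq_bigr => k _.
by rewrite /nterm iter_Top1 -fmorphV -rmorphXn -rmorphM.
Qed.

Lemma L2_one : L2 mu one.
Proof.
apply/L2P; split; first by split; exact: measurable_cst.
rewrite /N2 (_ : (fun _ => _) = cst 1%E); last first.
  by apply/funext => x; rewrite /sqn /= expr1n expr0n addr0.
by rewrite integral_cst// mul1e [X in (X < _)%E](@probability_setT _ _ _ mu) ltry.
Qed.

Lemma L2_psum (l : R[i]) n : L2 mu (psum S l n one).
Proof. by have [+ _ _ _] := bounded_psum S l n; apply; exact: L2_one. Qed.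

(** By [avoidP_ewop] the sum is the mean of the partial Neumann sum of 1, whose square is at most
    the mean square. *)
Lemma sum_avoid_sqr_le (l : R) n : 0 < l ->
  (((\sum_(k < n) l^-1 ^+ k.+1 * a (k + m)) ^+ 2)%:E <= N2 mu (psum S l%:C%C n one))%E.
Proof.
move=> l0; set P := psum _ _ _ _.
have [mP _] := (L2P mu P).1 (L2_psum _ n).
have sn1 : snn (cst 1%E : seq R -> \bar R) by exact: snn_cst.
have q0 k : 0 <= l^-1 ^+ k by rewrite exprn_ge0// invr_ge0 ltW.
rewrite N2E//; apply: le_trans (leeDl _ _); last exact: (snn_iter m (snn_sqr (smf_im mP))).2.
apply: L1_sqr_le; first exact: smf_re.
  by apply: sumr_ge0 => k _; rewrite mulr_ge0// avoidP_ge0.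
rewrite -sumEFin; under eq_bigr do rewrite EFinM avoidP_ewop.
have -> : iter m iint (fun s => `|re P s|%:E) [::] =
   iter m iint (fun s => \sum_(k < n) (l^-1 ^+ k.+1)%:E * iter k ewop (cst 1) s)%E [::].
  apply: eq_iter_iint => u; rewrite addn0 => um.
  have := ext_tuple P (Tuple (introT eqP um)) => /= E.
  rewrite /re E /P psum1 /= ger0_norm; last first.
    by apply: sumr_ge0 => k _; rewrite mulr_ge0// wop1_ge0.
  by rewrite /rsum -sumEFin; apply: eq_bigr => k _; rewrite EFinM wop1_ewop.
rewrite iter_iint_sum; last first.
  by move=> k; apply: snnM; [apply: snn_cst; rewrite lee_fin|exact: snn_ewop].
apply: lee_sum => k _; rewrite iter_iintZ ?lee_fin//; exact: snn_ewop.
Qed.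

(* When [L = 0] only the constant term of the Neumann series is controlled. *)
Lemma avoid_lower : exists K, [/\ 0 < K, K <= 1 & forall k, K * L ^+ k <= a (k + m)].
Proof.
suff [K K0 Ka] : exists2 K, 0 < K & forall k, K * L ^+ k <= a (k + m).
  exists K; split => //; have := Ka 0%N; rewrite expr0 mulr1 add0n => /le_trans; apply.
  exact: avoidP_le1.
have Lle k : L ^+ k <= a k.
  apply: growth_le; [exact: avoidP_ge0|exact: avoidP_le1|by rewrite avoidP_short].
have [L0|L0] := eqVneq L 0.
  exists 1 => // -[|k]; first by rewrite expr0 mulr1 avoidP_short.
  by rewrite L0 expr0n mulr0 avoidP_ge0.
exists (L ^+ m); first by rewrite exprn_gt0// lt_def L0 growth_avoid_ge0.
by move=> k; rewrite -exprD addnC Lle.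
Qed.

(** With [P] the partial sum at [l = L + e] and [y = l^-n T^n 1], telescoping gives
    [(L - T) P = (1 - y) - e P]. As [y] lies in [[0, 1]] when [a n <= l ^ n], the squared norm of
    the right side is at most [2 e^2 |P|^2 + 2]. *)
Lemma N2_psum_le (A : (m.-tuple mR -> R[i]) -> m.-tuple mR -> R[i]) (M e : R) n :
  0 < e -> 0 <= M ->
  (forall f, L2 mu f -> (N2 mu (A f) <= M%:E * N2 mu f)%E) ->
  (forall f, L2 mu f -> L2 mu (A f)) ->
  (forall f, L2 mu f -> A (fun x => L%:C%C * f x - T f x) = f %[ae mu]) ->
  a n <= (L + e) ^+ n ->
  exists t, N2 mu (psum S (L + e)%:C%C n one) = t%:E /\ t <= M * (2 * e ^+ 2 * t + 2).
Proof.
move=> e0 M0 aM a1 aT an.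
set l := L + e; set P := psum _ _ _ _.
have l0 : 0 < l by rewrite ltr_wpDl// growth_avoid_ge0.
have P2 : L2 mu P := L2_psum _ n.
have [mP Poo] := (L2P mu P).1 P2.
have T2 : L2 mu (T P) by have [+ _ _ _] := bounded_Top R S; apply.
have D2 := L2B L%:C%C P2 T2.
set D : m.-tuple mR -> R[i] := (fun x => _) in D2.
have [mD _] := (L2P mu D).1 D2.
have [mAD _] := (L2P mu (A D)).1 (a1 _ D2).
have Pfin : N2 mu P \is a fin_num by rewrite ge0_fin_numE ?N2_ge0.
(* [A] undoes [L - T], so [A D = P] almost everywhere and a bound on [D] becomes a bound on [P]. *)
have PAD : N2 mu P = N2 mu (A D).
  apply: ge0_ae_eq_integral => //; try exact: measurable_sqn.
  - by move=> x _; rewrite lee_fin sqn_ge0.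
  - by move=> x _; rewrite lee_fin sqn_ge0.
  by have := aT P P2; apply: filterS => x /[apply] ->.
have lC0 : l%:C%C != 0 by rewrite fmorph_eq0 gt_eqF.
have h1 x : (0 <= (2 * e ^+ 2)%:E * (sqn (P x))%:E)%E.
  by rewrite mule_ge0// lee_fin ?sqn_ge0// mulr_ge0// sqr_ge0.
have Dle : (N2 mu D <= (2 * e ^+ 2)%:E * N2 mu P + 2%:E)%E.
  have -> : ((2 * e ^+ 2)%:E * N2 mu P + 2%:E)%E =
      (\int[mu]_x ((2 * e ^+ 2)%:E * (sqn (P x))%:E + cst 2%:E x))%E.
    have m1 : measurable_fun setT (fun x => (2 * e ^+ 2)%:E * (sqn (P x))%:E)%E.
      by apply: measurable_funeM; exact: measurable_sqn.
    rewrite (@ge0_integralD _ _ _ mu setT measurableT _ (cst 2%:E)%E (fun x _ => h1 x) m1)//.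
      rewrite integral_cst// [X in (_ = _ + _ * X)%E](@probability_setT _ _ _ mu) mule1.
      congr (_ + _)%E; rewrite ge0_integralZl//; first exact: measurable_sqn.
        by move=> x _; rewrite lee_fin sqn_ge0.
      by rewrite lee_fin mulr_ge0// sqr_ge0.
    by move=> x _; rewrite lee_fin.
  apply: ae_ge0_le_integral => //.
  - by move=> x _; rewrite lee_fin sqn_ge0.
  - exact: measurable_sqn.
  - by move=> x _; rewrite adde_ge0// lee_fin.
  - apply: emeasurable_funD; last exact: measurable_cst.
    by apply: measurable_funeM; exact: measurable_sqn.
  have := Top_psum S n lC0 L2_one; apply: filterS => x TP _.
  pose y := l^-1 ^+ n * iter n wop (cst 1) x.
  have y0 : 0 <= y by rewrite mulr_ge0 ?wop1_ge0// exprn_ge0// invr_ge0 ltW.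
  have y1 : y <= 1.
    rewrite /y exprVn ler_pdivrMl ?exprn_gt0// mulr1.
    exact: le_trans (wop1_le n x) an.
  have -> : D x = ((1 - y) - e * rsum l n x)%:C%C.
    have -> : (1 - y) - e * rsum l n x = L * rsum l n x - (l * rsum l n.+1 x - 1).
      rewrite [rsum l n.+1 x]big_ord_recr/= -/(rsum l n x) mulrDr [l^-1 ^+ n.+1]exprS.
      by rewrite !mulrA mulfV ?gt_eqF// mul1r -/y /l; ring.
    by rewrite /D TP /P !psum1 [RHS]rmorphB rmorphM rmorphB rmorphM rmorph1.
  have -> : sqn (P x) = rsum l n x ^+ 2.
    by rewrite /P psum1 /sqn /= expr0n addr0.
  rewrite -EFinM -EFinD lee_fin /sqn /= expr0n addr0.
  apply: le_trans (_ : 2 * (1 - y) ^+ 2 + 2 * (e * rsum l n x) ^+ 2 <= _).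
    rewrite -subr_ge0 (_ : _ - _ = ((1 - y) + e * rsum l n x) ^+ 2) ?sqr_ge0//; ring.
  rewrite addrC exprMn mulrA lerD2l -[leRHS]mulr1 ler_wpM2l//.
  by rewrite expr_le1// ?subr_ge0// gerBl.
exists (fine (N2 mu P)); split; first by rewrite fineK.
rewrite -lee_fin fineK// {1}PAD; apply: le_trans (aM _ D2) _.
rewrite EFinM; apply: lee_wpmul2l; first by rewrite lee_fin.
by move: Dle; rewrite -[X in (_ * X)%E](fineK Pfin) -EFinM -EFinD.
Qed.

(** Here [t] is the squared norm of the partial sum and [p] its weighted sum of avoidance
    probabilities. Since [e (1 + M) = K / 8 <= 1/8], the coefficient [2 e^2 M] is at most [1/2] and
    [t <= 4 M]; but [p >= K / (2 e) = 4 (1 + M)], so [p^2] exceeds [4 M]. *)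
Lemma no_bounded_resolvent (F : realFieldType) (K M e t p : F) :
  K <= 1 -> 0 <= M -> 0 < e -> e * (8 * (1 + M)) = K ->
  t <= M * (2 * e ^+ 2 * t + 2) -> p ^+ 2 <= t -> K * 2^-1 <= p * e -> False.
Proof.
move=> K1 M0 e0 eM tM pt pK.
have p4 : 4 * (1 + M) <= p.
  by rewrite -(ler_pM2r e0); apply: le_trans pK; rewrite -eM; lra.
have e8 : e * (1 + M) <= 8^-1 by lra.
have M1 : 0 < 1 + M by rewrite ltr_pwDl.
have eM2 : 2 * e ^+ 2 * M <= 2^-1.
  have eM0 : 0 <= e * (1 + M) by rewrite mulr_ge0// ltW.
  have h1 : (e * (1 + M)) ^+ 2 <= 8^-1 ^+ 2 by rewrite lerXn2r ?nnegrE// invr_ge0.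
  have h2 : e ^+ 2 * M <= (e * (1 + M)) ^+ 2.
    by rewrite exprMn; apply: ler_wpM2l; [exact: sqr_ge0|nra].
  by rewrite [8^-1 ^+ 2]expr2 in h1; lra.
have t0 : 0 <= t by apply: le_trans pt; exact: sqr_ge0.
have h1 : 2 * e ^+ 2 * M * t <= 2^-1 * t by rewrite ler_wpM2r.
have p0 : 0 <= 4 * (1 + M) by rewrite mulr_ge0// ltW.
have h2 : (4 * (1 + M)) ^+ 2 <= p ^+ 2 by rewrite lerXn2r ?nnegrE// (le_trans p0).
have h3 : t <= 4 * M.
  have : M * (2 * e ^+ 2 * t + 2) = 2 * e ^+ 2 * M * t + 2 * M by ring.
  lra.
have h4 : (4 * (1 + M)) ^+ 2 = 16 + 32 * M + 16 * M ^+ 2 by ring.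
by have := sqr_ge0 M; lra.
Qed.

Lemma growth_spectrum : spectrum mu T L%:C%C.
Proof.
move=> [A [/bounded_operatorP[a1 _ _ [M M0 aM]] AT]].
have [K [K0 K1 Ka]] := avoid_lower.
pose e := K / (8 * (1 + M)).
have M1 : 0 < 1 + M by rewrite ltr_pwDl.
have e0 : 0 < e by rewrite divr_gt0// mulr_gt0.
have eM : e * (8 * (1 + M)) = K by rewrite divfK// gt_eqF// mulr_gt0.
have L0 : 0 <= L := growth_avoid_ge0 R S.
pose l := L + e.
have l0 : 0 < l by rewrite ltr_wpDl.
have Ll : L < l by rewrite ltrDl.
have [r [Lr rl]] : exists r, L < r /\ r < l.
  by exists ((L + l) / 2); split; rewrite midf_lt.
have r0 : 0 <= r by apply: le_trans (ltW Lr).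
have [C C0 aC] := lt_growth_avoid Lr.
have ql q : 0 <= q -> q < l -> `|q / l| < 1.
  by move=> q0 ql; rewrite ger0_norm ?divr_ge0 ?(ltW l0)// ltr_pdivrMr// mul1r.
(* The first condition yields [a n <= l ^ n]; the second keeps at least half of the full geometric
   sum [1 / e] in the lower bound for the mean. *)
have [n [n1 n2]] : exists n, C * (r / l) ^+ n <= 1 /\ (L / l) ^+ n <= 2^-1.
  have half0 : (0 : R) < 2^-1 by rewrite invr_gt0.
  have /cvgrPdist_le/(_ 1 ltr01)[N1 _ h1] := cvg_geometric C (ql r r0 rl).
  have /cvgrPdist_le/(_ _ half0)[N2 _ h2] := cvg_geometric 1 (ql L L0 Ll).
  exists (maxn N1 N2); split.
    have := h1 (maxn N1 N2) (leq_maxl _ _).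
    by rewrite /= /geometric /= sub0r normrN => /(le_trans (ler_norm _)).
  have := h2 (maxn N1 N2) (leq_maxr _ _).
  by rewrite /= /geometric /= sub0r normrN mul1r => /(le_trans (ler_norm _)).
have an : a n <= l ^+ n.
  apply: le_trans (aC n) _; move: n1.
  by rewrite expr_div_n mulrA ler_pdivrMr ?mul1r// exprn_gt0.
have [t [Pt tM]] := N2_psum_le e0 M0 aM a1 (fun f f2 => (AT f f2).1) an.
have := sum_avoid_sqr_le n l0; rewrite Pt lee_fin; set p := \sum_(k < n) _ => pt.
(* A geometric sum with [e = l - L]; multiplying by [e] avoids a division. *)
have geo N : (\sum_(k < N) l^-1 ^+ k.+1 * L ^+ k) * e = 1 - (L / l) ^+ N.
  elim: N => [|N IH]; first by rewrite big_ord0 mul0r expr0 subrr.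
  rewrite big_ord_recr mulrDl IH /= !expr_div_n !exprVn !exprS.
  have -> : e = l - L by rewrite /l addrC addKr.
  by field; rewrite ?expf_neq0 ?gt_eqF.
have pK : K * 2^-1 <= p * e.
  apply: le_trans (_ : K * (1 - (L / l) ^+ n) <= _).
    by rewrite ler_pM2l//; lra.
  rewrite -geo mulrA ler_pM2r// mulr_sumr; apply: ler_sum => k _.
  by rewrite mulrCA ler_wpM2l// exprn_ge0// invr_ge0 ltW.
exact: (no_bounded_resolvent K1 M0 e0 eM tM pt pK).
Qed.

Lemma spectral_radius_Top : spectral_radius mu T = L%:E.
Proof.
apply/eqP; rewrite eq_le; apply/andP; split.
  apply: ge_ereal_sup => _ [l sl <-]; rewrite lee_fin leNgt; apply/negP => Ll.
  exact: sl (resolvent_gt_growth Ll).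
apply: ereal_sup_ubound; exists L%:C%C; first exact: growth_spectrum.
by rewrite normc_sqn /sqn /= expr0n addr0 sqrtr_sqr ger0_norm// growth_avoid_ge0.
Qed.

End growth_in_spectrum.

Theorem theorem2p12 (R : realType) (m : nat) (hm : (2 <= m)%N)
    (S : {set 'S_m.+1}) :
  (((alpha S n)%:R / n`!%:R : R) `^ n%:R^-1)%:E @[n --> \oo] -->
    spectral_radius (cube R m) (Top S).
Proof.
rewrite spectral_radius_Top; apply: cvg_EFin; first by apply: nearW.
under eq_fun do rewrite /= -avoidP_alpha.
apply: cvg_growth.
- exact: avoidP_ge0.
- exact: avoidP_le1.
- by rewrite avoidP_short.
- exact: avoidP_submul.
Qed.
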